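(* Let $\zeta_{2,2}(s)=\sum_{n=1}^\infty g(n,2,2)\,n^{-s}$ be the Dirichlet generating function enumerating isomorphism classes of finite nilpotent groups of class at most $2$ generated by at most $2$ elements. Then $$\zeta_{2,2}(s)=\zeta(s)\,\zeta(2s)\,\zeta(3s)^2\,\zeta(4s),$$ where $\zeta(s)=\sum_{n=1}^\infty n^{-s}$ is the Riemann zeta function.
   Context: For positive integers $c$ and $d$, $\mathcal{N}(c,d)$ denotes the set of isomorphism classes of finite nilpotent groups of nilpotency class at most $c$ that can be generated by at most $d$ elements (the trivial group is included). For a positive integer $n$, $g(n,c,d):=\#\{G\in\mathcal{N}(c,d) : |G|=n\}$. The Dirichlet generating function is $\zeta_{c,d}(s):=\sum_{n=1}^\infty g(n,c,d)\,n^{-s}$, where $s$ is a complex variable. The asserted identity is an identity of Dirichlet series. *)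

(* Defs.v *)
From HB Require Import structures.
From mathcomp Require Import all_boot all_order all_algebra all_fingroup all_solvable.

Set Implicit Arguments.
Unset Strict Implicit.
Unset Printing Implicit Defensive.

Section IsoClasses.

Local Open Scope group_scope.

(* G is nilpotent of class at most c and generated by at most d elements;
   'm(G) is the least cardinality of a generating set of G. *)
Definition in_Ncd (c d : nat) (gT : finGroupType) (G : {group gT}) : bool :=
  [&& nilpotent G, nil_class G <= c & 'm(G) <= d].

(* By Cayley's theorem every group of order n is isomorphic to a subgroup of
   'S_n, so the isomorphism classes of groups of order n are the \isog-classes
   of subgroups of order n of 'S_n; see isoclasses_exhaustive and
   isoclasses_isog below. *)
Definition Ncd_subgroups (n c d : nat) : {set {group 'S_n}} :=
  [set G : {group 'S_n} | (#|G| == n) && in_Ncd c d G].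

Definition isoclasses (n c d : nat) : {set {set {group 'S_n}}} :=
  equivalence_partition (fun G H : {group 'S_n} => G \isog H)
    (Ncd_subgroups n c d).

Definition gcount (n c d : nat) : nat := #|isoclasses n c d|.

Lemma isog_in_Ncd c d (gT rT : finGroupType) (G : {group gT}) (H : {group rT}) :
  G \isog H -> in_Ncd c d G = in_Ncd c d H.
Proof.
move=> isoGH; rewrite /in_Ncd (isog_nil isoGH) (isog_grank isoGH).
by rewrite (isog_nil_class isoGH).
Qed.

Lemma cayley (gT : finGroupType) (G : {group gT}) :
  exists H : {group 'S_#|G|}, G \isog H.
Proof.
have cardG : #|{: subg_of G}| = #|G| by rewrite -cardsT -(card_isog (isog_subg G)).
pose h (x : subg_of G) : 'I_#|G| := cast_ord cardG (enum_rank x).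
pose k (i : 'I_#|G|) : subg_of G := enum_val (cast_ord (esym cardG) i).
have hK : cancel h k by move=> x; rewrite /k /h cast_ordK enum_rankK.
have kK : cancel k h by move=> i; rewrite /k /h enum_valK cast_ordKV.
pose f0 (x : subg_of G) (i : 'I_#|G|) := h (k i * x).
have f0I x : injective (f0 x).
  by move=> i j /(can_inj hK)/mulIg/(can_inj kK).
pose f (x : subg_of G) : 'S_#|G| := perm (@f0I x).
have fM : {in [set: subg_of G] &, {morph f : x y / x * y}}.
  by move=> x y _ _; apply/permP=> i; rewrite permM !permE /f0 hK mulgA.
pose fm := Morphism fM.
have injf : 'injm fm.
  apply/injmP=> x y _ _ /= /permP /(_ (h 1)).
  by rewrite !permE /f0 hK !mul1g => /(can_inj hK).
exists (fm @* [set: subg_of G])%G.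
by rewrite (isog_trans (isog_subg G)) // sub_isog.
Qed.

Lemma isog_equiv_rel n (A : {set {group 'S_n}}) :
  {in A & &, equivalence_rel (fun G H : {group 'S_n} => G \isog H)}.
Proof.
move=> G H K _ _ _; split; first exact: isog_refl.
move=> isoGH; apply/idP/idP; last exact: isog_trans.
by apply: isog_trans; rewrite isog_sym.
Qed.

Lemma isoclasses_exhaustive c d (gT : finGroupType) (G : {group gT}) :
  in_Ncd c d G ->
  exists2 B, B \in isoclasses #|G| c d
    & forall H : {group 'S_#|G|}, (H \in B) = (G \isog H).
Proof.
move=> NG; have [K isoGK] := cayley G.
have inN (H : {group 'S_#|G|}) : G \isog H -> H \in Ncd_subgroups #|G| c d.
  by move=> iGH; rewrite inE -(isog_in_Ncd c d iGH) NG -(card_isog iGH) eqxx.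
exists [set H in Ncd_subgroups #|G| c d | K \isog H].
  by apply: imset_f; apply: inN.
move=> H; rewrite inE; apply/andP/idP => [[_]|iGH]; first exact: isog_trans.
by split; [apply: inN | rewrite isog_sym in isoGK; apply: isog_trans isoGK iGH].
Qed.

Lemma isoclasses_isog n c d (B : {set {group 'S_n}}) (G H : {group 'S_n}) :
  B \in isoclasses n c d -> G \in B ->
  [/\ #|G| = n, in_Ncd c d G
    & (H \in B) = (#|H| == n) && (G \isog H)].
Proof.
case/imsetP=> K; rewrite inE => /andP[/eqP oK NK] ->.
rewrite !inE => /andP[/andP[/eqP oG NG] isoKG]; split=> //.
apply/andP/andP=> [[/andP[/eqP-> _] iKH]|[/eqP oH iGH]]; split=> //.
- by apply: isog_trans iKH; rewrite isog_sym.
- by rewrite oH eqxx -(isog_in_Ncd c d iGH).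
- exact: isog_trans iGH.
Qed.

End IsoClasses.

(* A formal Dirichlet series sum_(n >= 1) a_n n^-s is its coefficient sequence
   a : nat -> nat; the value at 0 is irrelevant. *)
Section FormalDirichlet.

Local Open Scope nat_scope.

Definition dmul (a b : nat -> nat) (n : nat) : nat :=
  \sum_(m <- divisors n) a m * b (n %/ m).

(* Substitution of k * s for s: the term a_m m^-(k s) is a_m (m ^ k)^-s. *)
Definition ddil (k : nat) (a : nat -> nat) (n : nat) : nat :=
  \sum_(1 <= m < n.+1 | m ^ k == n) a m.

Definition dzeta (n : nat) : nat := 1.

End FormalDirichlet.

Declare Scope dirichlet_scope.
Delimit Scope dirichlet_scope with D.
Notation "a * b" := (dmul a b) : dirichlet_scope.

From mathcomp Require Import complex.
From mathcomp Require Import all_classical all_reals all_analysis.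
Import Order.TTheory GRing.Theory Num.Theory.
Import numFieldNormedType.Exports.

Section AnalyticDirichlet.

Local Open Scope classical_set_scope.
Local Open Scope ring_scope.
Local Open Scope complex_scope.

Variable R : realType.

Definition cexp (z : R[i]) : R[i] :=
  (expR (complex.Re z))%:C * (cos (complex.Im z) +i* sin (complex.Im z)).

(* n ^ - s, for n >= 1. *)
Definition npowN (n : nat) (s : R[i]) : R[i] := cexp (- s * (ln n%:R)%:C).

(* R[i]^o carries the usual topology of the complex plane. *)
Definition dpartial (a : nat -> nat) (s : R[i]) (N : nat) : R[i]^o :=
  \sum_(1 <= n < N.+1) (a n)%:R * npowN n s.

(* Only meaningful where the series converges. *)
Definition dirichlet (a : nat -> nat) (s : R[i]) : R[i] :=
  limn (dpartial a s).

Definition zeta (s : R[i]) : R[i] := dirichlet (fun=> 1%N) s.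

End AnalyticDirichlet.

(* Main.v *)
(* A two-generator group G of class at most 2 with commutator z = [x, y] of order
   k and abelianization Z/rm x Z/m, k | m, is determined by the two relations
   x^(rm) = z^i and y^m = z^j. The map g -> g^(rm) is linear up to the term
   T = binomial(rm, 2), an involution modulo k, and writing i = I + T, j = J + T
   makes the action of base changes on (I, J) linear, uniformly in all primes
   including 2: one may add multiples of rJ to I, multiples of I to J, and scale
   both by units. Hence (I, J) can be brought to the form (ce, c) with e | r and
   ce | k, and the subgroups generated modulo k by (I, rJ) and (I, J) show that c
   and e are invariants. With k = cde, r = ae and m = bk the order of G is
   a b^2 c^3 d^3 e^4, so the isomorphism classes of order n correspond to the
   factorizations of n of this shape, one zeta factor for each of a, b, c, d, e. *)
Require Import Defs.
From HB Require Import structures.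
From mathcomp Require Import all_boot all_order all_algebra all_fingroup all_solvable.
From mathcomp Require Import zify.

Set Implicit Arguments.
Unset Strict Implicit.
Unset Printing Implicit Defensive.

(** * Arithmetic modulo the order of the commutator *)

Lemma prime_dvdn_partn (pi : nat_pred) n p :
  0 < n -> prime p -> (p %| n`_pi) = (p \in pi) && (p %| n).
Proof.
move=> n_gt0 p_pr; have := primes_part pi n => /(congr1 (fun s => p \in s)).
by rewrite mem_filter !mem_primes p_pr part_gt0 n_gt0.
Qed.

(** The witness is the part of [k] supported on the primes that do not divide [i]. A prime of [k]
    not dividing [i] divides [b], hence not [i + b * j]; a prime of [k] dividing [i] divides neither
    [b] nor, by the gcd hypothesis, [j]. *)
Lemma coprime_addMr i j k : 0 < k -> gcdn (gcdn i j) k = 1 ->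
  exists b, coprime (i + b * j) k.
Proof.
move=> k_gt0 ijk1; exists (k`_[pred p | ~~ (p %| i)]).
apply: contraT => /eqP; set g := gcdn _ k => g1.
have g_gt0 : 0 < g by rewrite gcdn_gt0 k_gt0 orbT.
have /pdivP[p p_pr] : 1 < g by rewrite ltn_neqAle g_gt0 andbT eq_sym; apply/eqP.
rewrite dvdn_gcd => /andP[pij pk].
have p1 : ~~ (p %| 1) by rewrite dvdn1; apply: contraL p_pr => /eqP->.
have [pi|pNi] := boolP (p %| i); last first.
  have pb : p %| k`_[pred p | ~~ (p %| i)].
    by rewrite prime_dvdn_partn // inE /= pNi pk.
  by move: pij; rewrite dvdn_addl ?dvdn_mulr // (negbTE pNi).
move: pij; rewrite dvdn_addr // Euclid_dvdM //.
rewrite prime_dvdn_partn // inE /= pi /= => pj.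
by case/negP: p1; rewrite -ijk1 !dvdn_gcd pi pj pk.
Qed.

Lemma gcdn_addMr i j k : 0 < k ->
  exists b, gcdn (i + b * j) k = gcdn (gcdn i j) k.
Proof.
move=> k_gt0; set d := gcdn (gcdn i j) k.
have d_gt0 : 0 < d by rewrite gcdn_gt0 k_gt0 orbT.
have di : d %| i by rewrite !(dvdn_trans (dvdn_gcdl _ _)).
have dj : d %| j by rewrite (dvdn_trans (dvdn_gcdl _ _)) ?dvdn_gcdr.
have dk : d %| k by rewrite dvdn_gcdr.
have k1_gt0 : 0 < k %/ d by rewrite divn_gt0 // dvdn_leq.
have [|b b_cop] := @coprime_addMr (i %/ d) (j %/ d) (k %/ d) k1_gt0.
  apply/eqP; rewrite -(eqn_pmul2r d_gt0) mul1n !muln_gcdl.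
  by rewrite !divnK.
exists b; rewrite -{1}(divnK di) -{1}(divnK dj) -{1}(divnK dk).
by rewrite mulnA -mulnDl -muln_gcdl (eqP b_cop) mul1n.
Qed.

(** The quotient of [i] by [d = gcdn i k] is a unit only modulo [k %/ d]; adding a multiple of that
    modulus makes it coprime to any prescribed [m]. With [m] the order of the group, raising an
    element to the power [u] preserves the cyclic subgroup it generates. *)
Lemma unit_lift i k m : 0 < k -> 0 < m ->
  exists2 u, coprime u m & u * gcdn i k = i %[mod k].
Proof.
move=> k_gt0 m_gt0; set d := gcdn i k.
have d_gt0 : 0 < d by rewrite gcdn_gt0 k_gt0 orbT.
have [|b b_cop] := @coprime_addMr (i %/ d) (k %/ d) m m_gt0.
  suff -> : gcdn (i %/ d) (k %/ d) = 1 by rewrite gcd1n.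
  apply/eqP; rewrite -(eqn_pmul2r d_gt0) mul1n muln_gcdl.
  by rewrite !divnK ?dvdn_gcdl ?dvdn_gcdr.
exists (i %/ d + b * (k %/ d)) => //.
rewrite mulnDl -mulnA !divnK ?dvdn_gcdl ?dvdn_gcdr //.
by rewrite addnC modnMDl.
Qed.

Lemma mul2_bin2 n : 2 * 'C(n, 2) = n * n.-1.
Proof. by rewrite -[2]/(1.+1) -mul_bin_diag bin1. Qed.

Lemma bin2M r m : 'C(r * m, 2) = r * 'C(m, 2) + 'C(r, 2) * m * m.
Proof.
apply/eqP; rewrite -(@eqn_pmul2l 2) //; apply/eqP.
rewrite mulnDr mulnCA -!mulnA (mulnA 2) !mul2_bin2.
case: r m => [|r] [|m]; rewrite ?mul0n ?muln0 //=.
rewrite !mulSn !mulnS !mulnDr !mulnDl; lia.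
Qed.

(* The discrepancy in [(xy)^m = x^m y^m [y,x]^'C(m, 2)], an involution modulo
   the order [k] of the commutator. *)
Section Twist.

Variables (k m r : nat).
Hypothesis dvd_km : k %| m.

Let T := 'C(r * m, 2).

Lemma twist2 : k %| 2 * T.
Proof. by rewrite mul2_bin2 dvdn_mulr // dvdn_mull. Qed.

Lemma twist_bin : r * 'C(m, 2) = T %[mod k].
Proof.
rewrite /T bin2M addnC -modnDml.
by have /eqP-> : k %| 'C(r, 2) * m * m; rewrite ?dvdn_mull.
Qed.

Lemma twist_even : ~~ odd r -> k %| T.
Proof.
move=> even_r; rewrite /dvdn -twist_bin -/(_ %| _).
rewrite -(even_halfK even_r) -muln2 -mulnA dvdn_mull // mul2_bin2.
exact: dvdn_mulr.
Qed.

(** Since [k] divides [2 * T], only the parity of [u] matters. *)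
Lemma twist_mul_odd u : (~~ odd u -> k %| T) -> u * T = T %[mod k].
Proof.
rewrite -[u in u * _](odd_double_half u) mulnDl => kT.
rewrite -muln2 -mulnA addnC -modnDml.
have /eqP-> : k %| u./2 * (2 * T) by rewrite dvdn_mull ?twist2.
case: (odd u) kT => [|/(_ isT) /eqP]; rewrite ?mul1n // => ->.
by rewrite mod0n.
Qed.

Lemma twist_odd_order : odd k -> k %| T.
Proof. by move=> odd_k; rewrite -(@Gauss_dvdr _ 2) ?twist2 // coprimen2. Qed.

Lemma twist_coprime u : coprime u k -> u * T = T %[mod k].
Proof.
move=> cop; apply: twist_mul_odd => even_u; apply: twist_odd_order.
by rewrite -coprime2n (coprime_dvdl _ cop) // dvdn2.
Qed.

(** [T] vanishes modulo [k] unless [k] is even and [r] odd. In that case [D] is odd, so the matrix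
    with rows [a, b] and [c, d] is invertible modulo 2 and has no zero row there; and
    [a + b + a * b], congruent to 1 - (1 - a)(1 - b) modulo 2, is even only for a zero row. *)
Lemma twist_row a b c d D :
    coprime D k -> D + b * (r * c) = a * d %[mod k] ->
  (a + r * b + a * b) * T = T %[mod k] /\ (c + d + c * d) * T = T %[mod k].
Proof.
move=> cop detD; have [odd_k|even_k] := boolP (odd k).
  by split; apply: twist_mul_odd => _; apply: twist_odd_order.
have [odd_r|even_r] := boolP (odd r); last first.
  by split; apply: twist_mul_odd => _; apply: twist_even.
have odd_D : odd D.
  by rewrite -coprime2n coprime_sym (coprime_dvdr _ cop) // dvdn2.
have : odd (D + b * (r * c)) = odd (a * d).
  move/(congr1 (fun x => x %% 2)): detD; rewrite !modn_dvdm ?dvdn2 //.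
  by rewrite !modn2 => /(congr1 odd); rewrite !oddb.
rewrite !(oddD, oddM) odd_D odd_r /= => parity.
split; apply: twist_mul_odd; rewrite !(oddD, oddM) ?odd_r /=;
  by case: (odd a) (odd b) (odd c) (odd d) parity => [] [] [] [].
Qed.

End Twist.

(** * Two-generator groups of class two *)

(* The product of the normal forms [y^b x^a z^c], with the carries
   [x^p = z^i] and [y^q = z^j]. *)
Section Model.

Variables (p q k i j : nat).
Hypotheses (p_gt0 : 0 < p) (q_gt0 : 0 < q) (k_gt0 : 0 < k).
Hypotheses (dvd_kp : k %| p) (dvd_kq : k %| q).

Let T := ('I_p * 'I_q * 'I_k)%type.

Let nf (b a c : nat) : T :=
  (Ordinal (ltn_pmod a p_gt0), Ordinal (ltn_pmod b q_gt0),
   Ordinal (ltn_pmod (c + i * (a %/ p) + j * (b %/ q)) k_gt0)).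

Let mul (t t' : T) : T :=
  nf (t.1.2 + t'.1.2) (t.1.1 + t'.1.1) (t.2 + t'.2 + t.1.1 * t'.1.2).

Let nfP (t : T) : t = nf t.1.2 t.1.1 t.2.
Proof.
case: t => [[a b] c]; congr (_, _, _); apply/val_inj => /=.
- by rewrite modn_small.
- by rewrite modn_small.
- by rewrite !divn_small // !muln0 !addn0 modn_small.
Qed.

Let eq_nf b a c b' a' c' :
    a = a' %[mod p] -> b = b' %[mod q] ->
    c + i * (a %/ p) + j * (b %/ q) = c' + i * (a' %/ p) + j * (b' %/ q) %[mod k] ->
  nf b a c = nf b' a' c'.
Proof. by move=> ea eb ec; congr (_, _, _); apply/val_inj. Qed.

(** This reduces the group laws to identities between unreduced triples of naturals. The cross term
    [a * b'] survives the reductions of [a] modulo [p] and [b'] modulo [q] because [k] divides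
    both. *)
Let nf_mul b a c b' a' c' :
  mul (nf b a c) (nf b' a' c') = nf (b + b') (a + a') (c + c' + a * b').
Proof.
have divD d n n' : 0 < d ->
    (n + n') %/ d = n %/ d + n' %/ d + (n %% d + n' %% d) %/ d.
  move=> d_gt0; rewrite {1}(divn_eq n d) {1}(divn_eq n' d).
  by rewrite addnACA -mulnDl divnMDl.
have modk d n : k %| d -> n %% d = n %[mod k] by apply: modn_dvdm.
apply: eq_nf; [exact: modnDm | exact: modnDm |].
rewrite [(a + a') %/ p]divD // [(b + b') %/ q]divD //=.
set w := (a %% p + a' %% p) %/ p; set w' := (b %% q + b' %% q) %/ q.
set X := c + _ + _; set X' := c' + _ + _.
have eqX : X %% k + X' %% k + a %% p * (b' %% q) = X + X' + a * b' %[mod k].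
  have eqab : a %% p * (b' %% q) = a * b' %[mod k].
    by rewrite -modnMm (modk p) // (modk q) // modnMm.
  by rewrite -modnDmr eqab modnDmr -modnDml modnDm modnDml.
rewrite -(addnA _ (i * w)) -modnDml eqX modnDml; congr (_ %% k).
by rewrite /X /X'; lia.
Qed.

Lemma model_exists :
  exists (hT : finGroupType) (f : nat -> nat -> nat -> hT) (co : hT -> nat * nat * nat),
  [/\ #|hT| = p * q * k,
      forall t, t = f (co t).1.1 (co t).1.2 (co t).2,
      forall b a c b' a' c',
        (f b a c * f b' a' c')%g = f (b + b') (a + a') (c + c' + a * b') &
      forall b a c b' a' c', f b a c = f b' a' c' <->
        [/\ a = a' %[mod p], b = b' %[mod q] &
            c + i * (a %/ p) + j * (b %/ q) =
            c' + i * (a' %/ p) + j * (b' %/ q) %[mod k]]].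
Proof.
(* In [inv t] times [t] the first two exponents are exactly [q] and [p], whose carries contribute
   [j] and [i]; the factor [k.-1] plays the role of -1 modulo [k] and cancels everything left. *)
pose inv (t : T) := nf (q - t.1.2) (p - t.1.1)
  (k.-1 * (t.2 + (p - t.1.1) * t.1.2 + i + j)).
have mulA : associative mul.
  move=> t t' t''; rewrite (nfP t) (nfP t') (nfP t'') !nf_mul !addnA.
  by congr nf; lia.
have mul1 : left_id (nf 0 0 0) mul.
  by move=> t; rewrite (nfP t) nf_mul !add0n mul0n addn0.
have mulV : left_inverse (nf 0 0 0) inv mul.
  move=> t; rewrite [X in mul _ X]nfP nf_mul.
  rewrite !subnK ?(ltnW (ltn_ord _)) //; apply: eq_nf; rewrite ?modnn ?mod0n //.
  rewrite !divnn !div0n p_gt0 q_gt0 !muln0 !muln1 !addn0 mod0n.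
  set s := t.2 + (p - t.1.1) * t.1.2 + i + j.
  rewrite [X in X %% k](_ : _ = k * s) ?modnMr //.
  by rewrite -[in RHS](prednK k_gt0) mulSn /s; lia.
pose hT : finGroupType := HB.pack ('I_p * 'I_q * 'I_k)%type
  (Finite_isGroup.Build ('I_p * 'I_q * 'I_k)%type mulA mul1 mulV).
exists hT, nf, (fun t : T => (t.1.2 : nat, t.1.1 : nat, t.2 : nat)); split=> //.
- by rewrite -[#|_|]/(#|{: T}|) !card_prod !card_ord.
by move=> b a c b' a' c'; split=> [[]|[]] *; [split | apply: eq_nf].
Qed.

End Model.

Section ClassTwo.

Import GroupScope.

(** * Normal forms for two elements with central commutator *)

Section ClassTwoPair.

Variables (gT : finGroupType) (x y : gT).

Let z := [~ x, y].

Hypothesis Cz : z \in 'C(<[x]> <*> <[y]>).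

Definition nform (b a c : nat) : gT := y ^+ b * x ^+ a * [~ x, y] ^+ c.

Lemma commute_x_commg : commute x z.
Proof. by apply/commute_sym/(centP Cz); rewrite mem_gen // inE cycle_id. Qed.

Lemma commute_y_commg : commute y z.
Proof. by apply/commute_sym/(centP Cz); rewrite mem_gen // inE cycle_id orbT. Qed.

Lemma nform_mul b a c b' a' c' :
  nform b a c * nform b' a' c' = nform (b + b') (a + a') (c + c' + a * b').
Proof.
have cxy : x ^+ a * y ^+ b' = y ^+ b' * x ^+ a * z ^+ (a * b').
  by rewrite -(commXXg a b' commute_x_commg commute_y_commg) -commgC.
have cx n p : x ^+ n * z ^+ p = z ^+ p * x ^+ n by apply: commuteX2 commute_x_commg.
have cy n p : y ^+ n * z ^+ p = z ^+ p * y ^+ n by apply: commuteX2 commute_y_commg.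
have -> : nform b a c * nform b' a' c' =
    y ^+ b * (x ^+ a * y ^+ b') * x ^+ a' * z ^+ (c + c').
  rewrite expgD /nform -!mulgA (mulgA (z ^+ c)) -cy -mulgA.
  by rewrite (mulgA (z ^+ c)) -cx -mulgA.
rewrite cxy -!mulgA (mulgA (z ^+ _) (x ^+ _)) -cx -!mulgA -expgD addnC.
by rewrite (mulgA (x ^+ a)) -expgD mulgA -expgD mulgA.
Qed.

Lemma nform0 : nform 0 0 0 = 1.
Proof. by rewrite /nform !mulg1. Qed.

Lemma nform_exp b a c i :
  nform b a c ^+ i = nform (b * i) (a * i) (c * i + a * b * 'C(i, 2)).
Proof.
elim: i => [|i IHi]; first by rewrite !muln0 nform0.
rewrite expgSr IHi nform_mul binS bin1 !mulnS mulnDr.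
by congr nform; rewrite 1?addnC //; nia.
Qed.

(** The two products in opposite orders differ only in their last exponents, by [a * b'] against
    [a' * b]. So the commutator is [z] to the determinant of the exponents, written without
    subtraction. *)
Lemma nform_comm b a c b' a' c' :
  z ^+ (b * a') * [~ nform b a c, nform b' a' c'] = z ^+ (a * b').
Proof.
have := commgC (nform b a c) (nform b' a' c').
set u := [~ _, _] => /(congr1 (mulg (nform (b + b') (a + a') (c + c'))^-1)).
rewrite !nform_mul (addnC b') (addnC a') (addnC c').
have nformD i : nform (b + b') (a + a') (c + c' + i) =
    nform (b + b') (a + a') (c + c') * z ^+ i by rewrite /nform !expgD !mulgA.
rewrite !nformD; move: (nform _ _ (c + c')) => w.
by rewrite -!mulgA !mulKg (mulnC b) => <-.
Qed.

(** As [z] commutes with [x] and [y], and [x ^ y = x * z], each join is with a normalizing subgroup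
    and is therefore a plain product of sets. *)
Lemma nformP g : reflect (exists b a c, g = nform b a c) (g \in <[x]> <*> <[y]>).
Proof.
have nxz : <[z]> \subset 'N(<[x]>).
  by apply/cents_norm/cents_cycle/commute_sym/commute_x_commg.
have nyxz : <[y]> \subset 'N(<[x]> <*> <[z]>).
  rewrite cycle_subG inE -genJ gen_subG conjUg -!cycleJ subUset !cycle_subG.
  have -> : z ^ y = z by apply/conjg_fixP/commgP/commute_sym/commute_y_commg.
  by rewrite conjg_mulR groupM ?mem_gen ?inE ?cycle_id ?orbT.
apply: (iffP idP) => [|[b [a [c ->]]]]; last first.
  have xG : x \in <[x]> <*> <[y]> by rewrite mem_gen // inE cycle_id.
  have yG : y \in <[x]> <*> <[y]> by rewrite mem_gen // inE cycle_id orbT.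
  by rewrite !groupM ?groupX ?groupR.
have sGH : <[x]> <*> <[y]> \subset <[y]> <*> (<[x]> <*> <[z]>).
  by rewrite joingC genS ?setUS ?joing_subl.
move/(subsetP sGH); rewrite norm_joinEl //= norm_joinEr //.
case/mulsgP=> _ h /cycleP[b ->] /mulsgP[_ _ /cycleP[a ->] /cycleP[c ->] ->] ->.
by exists b, a, c; rewrite /nform mulgA.
Qed.

End ClassTwoPair.

(** * Generating pairs and their base changes *)

Section Pairs.

Variables (m r k : nat).
Hypothesis dvd_km : k %| m.

Let T := 'C(r * m, 2).

(* The offset [T] makes the action of base changes on [(I, J)] linear, see
   [hpair_change]. *)
Definition hpair (gT : finGroupType) (G : {set gT}) (I J : nat) (x y : gT) :=
  [&& <[x]> <*> <[y]> == G, [~ x, y] \in 'C(G), #[[~ x, y]] == k,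
      x ^+ (r * m) == [~ x, y] ^+ (I + T) & y ^+ m == [~ x, y] ^+ (J + T)].

Variables (gT : finGroupType) (G : {group gT}) (I J : nat) (x y : gT).
Hypothesis xyG : hpair G I J x y.

Let z := [~ x, y].

Lemma hpair_gen : <[x]> <*> <[y]> = G.
Proof. by case/and5P: xyG => /eqP. Qed.

Lemma hpair_cent : z \in 'C(<[x]> <*> <[y]>).
Proof. by case/and5P: xyG => /eqP->. Qed.

Lemma hpair_order : #[z] = k.
Proof. by case/and5P: xyG => _ _ /eqP. Qed.

Lemma hpair_der1 : G^`(1) = <[z]>.
Proof. by rewrite -hpair_gen (der1_joing_cycles hpair_cent). Qed.

Lemma hpair_eqX i j : z ^+ i = z ^+ j <-> i = j %[mod k].
Proof.
by rewrite -hpair_order; split=> /eqP eq_ij; apply/eqP;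
  rewrite eq_expg_mod_order in eq_ij *.
Qed.

Lemma hpair_dvdX i : k %| i -> z ^+ i = 1.
Proof. by rewrite -hpair_order order_dvdn => /eqP. Qed.

Lemma hpairP g : reflect (exists b a c, g = nform x y b a c) (g \in G).
Proof. by rewrite -hpair_gen; apply: (nformP hpair_cent). Qed.

Section BaseChange.

Variables (a b c a' b' c' D : nat).
Let u := nform x y b a c.
(** The exponent of [x] is taken divisible by [r] so that the [m]-th power of [v] still lands in
    [<[z]>]; [hpair_invariant] shows that this covers all pairs when the order of [G] is
    [r * m * m * k]. *)
Let v := nform x y b' (r * a') c'.
Hypotheses (copD : coprime D k) (uvD : [~ u, v] = z ^+ D).

Lemma hpair_det : D + b * (r * a') = a * b' %[mod k].
Proof.
apply/hpair_eqX; rewrite -(nform_comm hpair_cent b a c b' (r * a') c').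
by rewrite addnC expgD -uvD.
Qed.

Let zT := twist_row dvd_km copD hpair_det.

(** Collecting the power leaves [T] with the coefficient [a + r * b + a * b]: the first two terms
    come from the offsets, the last from the commutators. By [twist_row] this coefficient acts as 1,
    so the exponent is linear in [I] and [J] up to the same offset. *)
Lemma hpair_powx : u ^+ (r * m) = z ^+ (a * I + r * b * J + T).
Proof.
have [_ _ _ /eqP xm /eqP ym] := and5P xyG.
have ybm : y ^+ (b * (r * m)) = z ^+ ((J + T) * (r * b)).
  by rewrite mulnA (mulnC b) mulnC expgM ym -expgM.
have xam : x ^+ (a * (r * m)) = z ^+ ((I + T) * a).
  by rewrite mulnC expgM xm -expgM.
rewrite (nform_exp hpair_cent) /nform ybm xam -/z -!expgD.
transitivity (z ^+ (a * I + r * b * J + (a + r * b + a * b) * T + c * r * m)).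
  by congr (z ^+ _); rewrite /T; lia.
rewrite expgD [z ^+ (_ * m)]hpair_dvdX ?dvdn_mull // mulg1 2![z ^+ (_ + _)]expgD.
by congr (_ * _); apply/hpair_eqX; case: zT.
Qed.

Lemma hpair_powy : v ^+ m = z ^+ (a' * I + b' * J + T).
Proof.
have [_ _ _ /eqP xm /eqP ym] := and5P xyG.
have ybm : y ^+ (b' * m) = z ^+ ((J + T) * b').
  by rewrite mulnC expgM ym -expgM.
have xam : x ^+ (r * a' * m) = z ^+ ((I + T) * a').
  by rewrite mulnAC expgM xm -expgM.
rewrite (nform_exp hpair_cent) /nform ybm xam -/z -!expgD.
(* The commutators now contribute ['C(m, 2)] instead of ['C(r * m, 2)]; the factor [r] in the
   exponent of [x] makes up the difference modulo [k]. *)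
have zrC : z ^+ (r * 'C(m, 2)) = z ^+ T by apply/hpair_eqX/twist_bin.
have -> : z ^+ ((J + T) * b' + (I + T) * a' + (c' * m + r * a' * b' * 'C(m, 2)))
        = z ^+ (a' * I + b' * J + (a' + b' + a' * b') * T).
  rewrite [RHS](_ : _ = z ^+ ((J + T) * b' + (I + T) * a') * z ^+ (a' * b' * T)).
    rewrite expgD; congr (_ * _).
    rewrite expgD [z ^+ (_ * m)]hpair_dvdX ?dvdn_mull // mul1g.
    have -> : (r * a' * b' * 'C(m, 2) = r * 'C(m, 2) * (a' * b'))%N by lia.
    by rewrite expgM zrC -expgM mulnC.
  by rewrite -expgD; congr (z ^+ _); rewrite /T; lia.
rewrite 2![z ^+ (_ + _)]expgD.
by congr (_ * _); apply/hpair_eqX; case: zT.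
Qed.

Lemma hpair_twist i : [~ u, v] ^+ (i + T) = z ^+ (D * i + T).
Proof.
rewrite uvD -expgM mulnDr !expgD; congr (_ * _); apply/hpair_eqX.
exact: twist_coprime.
Qed.

(** The factor [D] on the left appears because [I'] and [J'] are exponents of the new commutator,
    which is [z ^+ D]. *)
Lemma hpair_change I' J' : <[u]> <*> <[v]> = G ->
    D * I' = a * I + r * b * J %[mod k] ->
    D * J' = a' * I + b' * J %[mod k] ->
  hpair G I' J' u v.
Proof.
move=> uvG eqI eqJ; have [_ cent_z /eqP oz _ _] := and5P xyG.
apply/and5P; split; first exact/eqP.
- by rewrite uvD groupX.
- rewrite uvD orderXgcd -/z hpair_order.
  by rewrite (eqP (_ : coprime k D)) ?divn1 // coprime_sym.
- by rewrite hpair_powx hpair_twist; apply/eqP/hpair_eqX/eqP; rewrite eqn_modDr eqI.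
- by rewrite hpair_powy hpair_twist; apply/eqP/hpair_eqX/eqP; rewrite eqn_modDr eqJ.
Qed.

Lemma hpair_changeV I' J' : hpair G I' J' u v ->
  D * I' = a * I + r * b * J %[mod k] /\ D * J' = a' * I + b' * J %[mod k].
Proof.
case/and5P=> _ _ _; rewrite hpair_powx hpair_powy !hpair_twist => /eqP eqI /eqP eqJ.
by split; apply/eqP; rewrite -(eqn_modDr T) eq_sym; apply/eqP/hpair_eqX.
Qed.

End BaseChange.
End Pairs.

Lemma eq_joing_cycles (gT : finGroupType) (G : {group gT}) (x y u v : gT) :
    <[x]> <*> <[y]> = G -> u \in G -> v \in G ->
    x \in <[u]> <*> <[v]> -> y \in <[u]> <*> <[v]> ->
  <[u]> <*> <[v]> = G.
Proof.
move=> defG Gu Gv xuv yuv; apply/eqP; rewrite eqEsubset.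
by rewrite -{2}defG !join_subG !cycle_subG Gu Gv xuv yuv.
Qed.

Lemma mem_joing_cycles (gT : finGroupType) (x y : gT) :
  (x \in <[x]> <*> <[y]>) && (y \in <[x]> <*> <[y]>).
Proof. by rewrite !mem_gen // inE cycle_id ?orbT. Qed.

Lemma mem_cycleX_coprime (gT : finGroupType) (G : {group gT}) (x : gT) i :
  x \in G -> coprime i #|G| -> x \in <[x ^+ i]>.
Proof.
move=> Gx cop; suff /eqP-> : <[x ^+ i]> == <[x]> by apply: cycle_id.
rewrite eq_sym -/(generator _ _) generator_coprime.
by rewrite coprime_sym (coprime_dvdr (order_dvdG Gx)).
Qed.

(** * Normal form and invariants of the exponents *)

Section Reduction.

Variables (m r k : nat).
Hypotheses (dvd_km : k %| m) (k_gt0 : 0 < k).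

Variables (gT : finGroupType) (G : {group gT}).

Lemma hpair_mem I J x y : hpair m r k G I J x y -> x \in G /\ y \in G.
Proof.
by move/hpair_gen=> <-; split; have /andP[] := mem_joing_cycles x y.
Qed.

Lemma hpair_addx I J x y b : hpair m r k G I J x y ->
  hpair m r k G (I + b * (r * J)) J (y ^+ b * x) y.
Proof.
move=> xyG; have [Gx Gy] := hpair_mem xyG.
have -> : y ^+ b * x = nform x y b 1 0 by rewrite /nform !mulg1.
have {2}-> : y = nform x y 1 (r * 0) 0 by rewrite /nform muln0 !mulg1.
apply: (hpair_change dvd_km xyG (D := 1)) => //; rewrite ?coprime1n //.
- have := nform_comm (hpair_cent xyG) b 1 0 1 (r * 0) 0.
  by rewrite !muln0 mul1g.
- have -> : nform x y 1 (r * 0) 0 = y by rewrite /nform muln0 !mulg1.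
  have -> : nform x y b 1 0 = y ^+ b * x by rewrite /nform !mulg1.
  have /andP[uW yW] := mem_joing_cycles (y ^+ b * x) y.
  apply: eq_joing_cycles (hpair_gen xyG) _ _ _ _; rewrite ?groupM ?groupX //.
  by move: uW; rewrite groupMl ?groupX.
by congr (_ %% _); lia.
Qed.

Lemma hpair_addy I J x y a : hpair m r k G I J x y ->
  hpair m r k G I (J + a * I) x (y * x ^+ (r * a)).
Proof.
move=> xyG; have [Gx Gy] := hpair_mem xyG.
have -> : y * x ^+ (r * a) = nform x y 1 (r * a) 0 by rewrite /nform !mulg1.
have {1}-> : x = nform x y 0 1 0 by rewrite /nform mulg1 mul1g.
apply: (hpair_change dvd_km xyG (D := 1)) => //; rewrite ?coprime1n //.
- have := nform_comm (hpair_cent xyG) 0 1 0 1 (r * a) 0.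
  by rewrite mul0n mul1g.
- have -> : nform x y 1 (r * a) 0 = y * x ^+ (r * a) by rewrite /nform !mulg1.
  have -> : nform x y 0 1 0 = x by rewrite /nform mulg1 mul1g.
  have /andP[xW vW] := mem_joing_cycles x (y * x ^+ (r * a)).
  apply: eq_joing_cycles (hpair_gen xyG) _ _ _ _; rewrite ?groupM ?groupX //.
  by move: vW; rewrite groupMr ?groupX.
- by congr (_ %% _); lia.
- by congr (_ %% _); lia.
Qed.

(** The commutator is raised to [a * b] but [x ^+ (r * m)] only to [a], so [I] gets divided by [b],
    and likewise [J] by [a]. Coprimality to the order of [G] ensures that the powers still
    generate. *)
Lemma hpair_scale I J I' J' x y a b : hpair m r k G I J x y ->
    coprime a #|G| -> coprime b #|G| ->
    b * I' = I %[mod k] -> a * J' = J %[mod k] ->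
  hpair m r k G I' J' (x ^+ a) (y ^+ b).
Proof.
move=> xyG copa copb eqI eqJ; have [Gx Gy] := hpair_mem xyG.
have -> : x ^+ a = nform x y 0 a 0 by rewrite /nform mulg1 mul1g.
have -> : y ^+ b = nform x y b (r * 0) 0 by rewrite /nform muln0 !mulg1.
have dvd_kG : k %| #|G|.
  by rewrite -(hpair_order xyG) order_dvdG // groupR.
apply: (hpair_change dvd_km xyG (D := a * b)) => //.
- by rewrite (coprime_dvdr dvd_kG) // coprimeMl copa.
- have := nform_comm (hpair_cent xyG) 0 a 0 b (r * 0) 0.
  by rewrite mul0n mul1g.
- have -> : nform x y b (r * 0) 0 = y ^+ b by rewrite /nform muln0 !mulg1.
  have -> : nform x y 0 a 0 = x ^+ a by rewrite /nform mulg1 mul1g.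
  apply: eq_joing_cycles (hpair_gen xyG) _ _ _ _; rewrite ?groupX //.
    by rewrite (subsetP (joing_subl _ _)) // (mem_cycleX_coprime Gx).
  by rewrite (subsetP (joing_subr _ _)) // (mem_cycleX_coprime Gy).
- by rewrite -mulnA -modnMmr eqI modnMmr muln0 mul0n addn0.
- by rewrite mulnAC -modnMml eqJ modnMml mul0n add0n mulnC.
Qed.

Lemma hpair_normal_form I J x y : hpair m r k G I J x y ->
  exists c e x' y',
    [/\ e %| r, c * e %| k & hpair m r k G (c * e) c x' y'].
Proof.
(* A multiple of [r * J] is added to [I] so that the gcd [A] of the result with [k] becomes that of
   [I], [r * J] and [k]. *)
move=> xyG; have [b gcd_b] := gcdn_addMr I (r * J) k_gt0.
move: gcd_b (hpair_addx b xyG); move: (I + b * (r * J)) => I1 gcdI1 xyG1.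
(* A multiple of [I1] is added to [J] so that [c] becomes the gcd of [J], [I1] and [k]; hence [c]
   divides [A]. *)
have [a gcd_a] := gcdn_addMr J I1 k_gt0.
move: gcd_a (hpair_addy a xyG1); set J2 := J + _; set c := gcdn J2 k.
set A := gcdn I1 k in gcdI1 * => def_c xyG2.
have [u copu uA] := unit_lift I1 k_gt0 (cardG_gt0 G).
have [v copv vc] := unit_lift J2 k_gt0 (cardG_gt0 G).
have c_gt0 : 0 < c by rewrite gcdn_gt0 k_gt0 orbT.
have cA : c %| A.
  rewrite dvdn_gcd dvdn_gcdr andbT def_c.
  by rewrite (dvdn_trans (dvdn_gcdl _ _)) ?dvdn_gcdr.
have Ak : A %| k by apply: dvdn_gcdr.
have ArJ : A %| r * J.
  by rewrite gcdI1 (dvdn_trans (dvdn_gcdl _ _)) ?dvdn_gcdr.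
have ArJ2 : A %| r * J2.
  by rewrite /J2 mulnDr dvdn_add // !dvdn_mull // dvdn_gcdl.
have Arc : A %| r * c.
  by rewrite /c muln_gcdr dvdn_gcd ArJ2 dvdn_mull.
(* Since [A] divides [r * c], the quotient [A %/ c] divides [r]. The units [v] and [u] strip [J2]
   and [I1] down to their gcds with [k]. *)
exists c, (A %/ c), ((y ^+ b * x) ^+ v), ((y * (y ^+ b * x) ^+ (r * a)) ^+ u).
have cE : (c * (A %/ c) = A)%N by rewrite mulnC divnK.
split; last by rewrite cE; exact: (hpair_scale xyG2 copv copu uA vc).
  by rewrite -(dvdn_pmul2l c_gt0) cE mulnC.
by rewrite cE.
Qed.

Lemma hpair_exp_mem I J x y g : hpair m r k G I J x y ->
  g \in G -> g ^+ (r * m) \in <[[~ x, y]]>.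
Proof.
move=> xyG /(hpairP xyG)[b [a [c ->]]]; rewrite (nform_exp (hpair_cent xyG)).
have [_ _ _ /eqP xm /eqP ym] := and5P xyG.
have ybm : y ^+ (b * (r * m)) = (y ^+ m) ^+ (b * r).
  by rewrite -expgM mulnA mulnC.
rewrite /nform ybm ym (mulnC a) [x ^+ _]expgM xm.
by rewrite !groupM ?groupX ?cycle_id.
Qed.

Hypothesis cardG : #|G| = (r * m * m * k)%N.

(** The abelianization has order [r * m * m] and is a product of two cyclic groups of orders
    dividing [r * m] and [m], so neither order can be smaller; in particular the coset of [x] has
    order exactly [r * m]. *)
Lemma hpair_dvdn_exp I J x y i : hpair m r k G I J x y ->
  x ^+ i \in <[[~ x, y]]> -> r * m %| i.
Proof.
move=> xyG xi; have [Gx Gy] := hpair_mem xyG.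
have defG' := hpair_der1 xyG; set N := G^`(1)%G.
have Nx : x \in 'N(N) by rewrite (subsetP (der_norm 1 G)).
have Ny : y \in 'N(N) by rewrite (subsetP (der_norm 1 G)).
have xN j : (coset N x ^+ j == 1) = (x ^+ j \in <[[~ x, y]]>).
  rewrite -morphX // -defG'; apply/eqP/idP; last exact: coset_id.
  by apply: coset_idr; rewrite groupX.
have yN j : (coset N y ^+ j == 1) = (y ^+ j \in <[[~ x, y]]>).
  rewrite -morphX // -defG'; apply/eqP/idP; last exact: coset_id.
  by apply: coset_idr; rewrite groupX.
have [_ _ _ /eqP xm /eqP ym] := and5P xyG.
have ox : #[coset N x] %| r * m by rewrite order_dvdn xN xm mem_cycle.
have oy : #[coset N y] %| m by rewrite order_dvdn yN ym mem_cycle.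
have rm_gt0 : 0 < r * m * m * k by rewrite -cardG cardG_gt0.
have [m_gt0 r_gt0] : 0 < m /\ 0 < r.
  by move: rm_gt0; rewrite !muln_gt0; case/andP=> /andP[/andP[]].
suff /eqP-> : (r * m == #[coset N x])%N by rewrite order_dvdn xN.
rewrite eqn_leq [in X in _ && X]dvdn_leq ?muln_gt0 ?r_gt0 // andbT.
rewrite -(leq_pmul2r m_gt0).
have <- : #|G / N| = (r * m * m)%N.
  rewrite card_quotient ?der_norm // -divgS ?der_sub //= defG' cardG.
  by rewrite -[#|_|]/(#[_]) (hpair_order xyG) mulnK.
have -> : G / N = <[coset N x]> * <[coset N y]>.
  rewrite -(hpair_gen xyG) quotientY ?cycle_subG // !quotient_cycle //.
  rewrite cent_joinEr //; apply: cents_cycle.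
  by apply: (centsP (der_abelian 0 G)); rewrite mem_quotient.
apply: (@leq_trans (#[coset N x] * #[coset N y])%N).
  by rewrite !orderE mul_cardG leq_pmulr ?cardG_gt0.
by rewrite leq_mul2l dvdn_leq ?orbT.
Qed.

(** Every other pair is a base change with unit determinant [D], so [I'] is a combination of [I] and
    [r * J] modulo [k], and [J'] one of [I] and [J], up to [D]. Used for [d = c] and [d = c * e]. *)
Lemma hpair_invariant I J I' J' x y x' y' d :
    hpair m r k G I J x y -> hpair m r k G I' J' x' y' -> d %| k -> d %| I ->
  (d %| J -> d %| J') /\ (d %| r * J -> d %| I').
Proof.
move=> xyG xyG' dk dI; have [Gx' Gy'] := hpair_mem xyG'.
have defG' : <[[~ x', y']]> = <[[~ x, y]]>.
  by rewrite -(hpair_der1 xyG) (hpair_der1 xyG').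
have [_ _ _ /eqP xm /eqP ym] := and5P xyG.
have [b [a [c def_x']]] := hpairP xyG _ Gx'.
have [b' [a0 [c' def_y']]] := hpairP xyG _ Gy'.
have m_gt0 : 0 < m.
  by have := cardG_gt0 G; rewrite cardG; case: (m) => //; rewrite muln0.
(* In normal form, [y' ^+ m] lies in the derived subgroup only if [x ^+ (a0 * m)] does, so [r * m]
   divides [a0 * m]. *)
have /dvdnP[a' def_a0] : r %| a0.
  rewrite -(dvdn_pmul2r m_gt0) (hpair_dvdn_exp xyG) //.
  have [_ _ _ _ /eqP ym'] := and5P xyG'.
  have : y' ^+ m \in <[[~ x, y]]> by rewrite ym' -defG' mem_cycle.
  rewrite def_y' (nform_exp (hpair_cent xyG)) /nform mulnC expgM ym.
  by rewrite -expgM groupMr ?mem_cycle // groupMl ?mem_cycle.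
rewrite {}def_a0 mulnC in def_y'.
have /cycleP[D def_z'] : [~ x', y'] \in <[[~ x, y]]> by rewrite -defG' cycle_id.
have copD : coprime D k.
  have := hpair_order xyG'; rewrite def_z' orderXgcd (hpair_order xyG) => /eqP.
  rewrite eq_sym eqn_div ?gcdn_gt0 ?k_gt0 ?dvdn_gcdl // -{3}[k]muln1.
  by rewrite eqn_pmul2l // gcdnC.
move: xyG' def_z'; rewrite def_x' def_y' => xyG' def_z'.
have [eqI eqJ] := hpair_changeV dvd_km xyG copD def_z' xyG'.
have copdD : coprime d D by rewrite coprime_sym (coprime_dvdr dk).
split=> [dJ|drJ].
  rewrite -(Gauss_dvdr _ copdD) /dvdn -(modn_dvdm _ dk) eqJ modn_dvdm //.
  by rewrite -/(d %| _) dvdn_add // dvdn_mull.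
rewrite -(Gauss_dvdr _ copdD) /dvdn -(modn_dvdm _ dk) eqI modn_dvdm //.
by rewrite -/(d %| _) dvdn_add // ?(mulnC r) -?mulnA dvdn_mull.
Qed.

End Reduction.

Lemma hpair_params_dvdn (gT : finGroupType) (G : {group gT})
    m r k I J (x y : gT) m' r' k' I' J' (x' y' : gT) :
    #|G| = (r * m * m * k)%N -> #|G| = (r' * m' * m' * k')%N ->
    hpair m r k G I J x y -> hpair m' r' k' G I' J' x' y' ->
  k = k' /\ r * m %| r' * m'.
Proof.
move=> cardG cardG' xyG xyG'.
have defG' : <[[~ x, y]]> = <[[~ x', y']]>.
  by rewrite -(hpair_der1 xyG) (hpair_der1 xyG').
have eq_k : k = k' by rewrite -(hpair_order xyG) -(hpair_order xyG') orderE defG'.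
have k_gt0 : 0 < k by rewrite -(hpair_order xyG) order_gt0.
split=> //; apply: (hpair_dvdn_exp k_gt0 cardG xyG); rewrite defG'.
by apply: (hpair_exp_mem xyG'); case: (hpair_mem xyG).
Qed.

(** [k] is the order of the derived subgroup, [r * m] the exponent of the abelianization, and the
    order of [G] then determines [m]. *)
Lemma hpair_params_inj (gT : finGroupType) (G : {group gT})
    m r k I J (x y : gT) m' r' k' I' J' (x' y' : gT) :
    #|G| = (r * m * m * k)%N -> #|G| = (r' * m' * m' * k')%N ->
    hpair m r k G I J x y -> hpair m' r' k' G I' J' x' y' ->
  [/\ k = k', m = m' & r = r'].
Proof.
move=> cardG cardG' xyG xyG'.
have [eq_k rm_dvd] := hpair_params_dvdn cardG cardG' xyG xyG'.
have [_ rm_dvd'] := hpair_params_dvdn cardG' cardG xyG' xyG.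
have /eqP eq_rm : (r * m == r' * m')%N by rewrite eqn_dvd rm_dvd.
have := cardG_gt0 G; rewrite cardG !muln_gt0.
case/andP=> /andP[/andP[r_gt0 m_gt0] _] k_gt0.
have eq_m : m = m'.
  have : (r * m * m * k = r * m * m' * k')%N by rewrite -cardG cardG' eq_rm.
  rewrite -eq_k => /eqP; rewrite eqn_pmul2r // eqn_pmul2l ?muln_gt0 ?r_gt0 //.
  by move/eqP.
split=> //; move/eqP: eq_rm; rewrite -eq_m eqn_pmul2r //.
by move/eqP.
Qed.

(** * Existence of a pair with power relations *)

Lemma abelian_two_generators (gT : finGroupType) (A : {group gT}) :
    abelian A -> 'm(A) <= 2 ->
  exists x y, [/\ <[x]> * <[y]> = A, #|A| = (#[x] * #[y])%N & #[y] %| #[x]].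
Proof.
move=> abA rkA; have [b defA ob] := abelian_structure abA.
have := size_abelian_type abA; rewrite -grank_abelian // -ob size_map.
have := abelian_type_dvdn_sorted A; rewrite -ob.
case: b defA {ob} => [|x [|y [|t b]]] defA.
- by exists 1, 1; rewrite -defA big_nil cycle1 cards1 order1 mulg1 ?mul1g.
- exists x, 1; rewrite -defA big_seq1 cycle1 mulg1 order1 muln1.
  by rewrite dvd1n.
- rewrite /= andbT => dvd_yx _; exists x, y; split=> //.
    move: defA; rewrite !big_cons big_nil dprodg1 => defA.
    by case/dprodP: defA.
  move: defA; rewrite !big_cons big_nil dprodg1 => defA.
  by rewrite -(dprod_card defA).
by move=> _ size_b; move: rkA; rewrite -size_b.
Qed.

Lemma hpair_exists (gT : finGroupType) (G : {group gT}) :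
    nilpotent G -> nil_class G <= 2 -> 'm(G) <= 2 ->
  exists m r k I J x y, [/\ k %| m, hpair m r k G I J x y &
    #|G| = (r * m * m * k)%N].
Proof.
move=> nilG cl2 rk2.
have sG'Z : G^`(1) \subset 'Z(G) by rewrite -nil_class2 // nilG.
have nG'G := der_norm 1 G.
have [||X [Y [defQ oQ dvd_YX]]] := @abelian_two_generators _ (G / G^`(1))%G.
- exact: der_abelian 0 G.
- by rewrite (leq_trans _ rk2) ?quotient_grank.
have QX : X \in G / G^`(1).
  by have := mem_mulg (cycle_id X) (group1 <[Y]>); rewrite mulg1 defQ.
have QY : Y \in G / G^`(1).
  by have := mem_mulg (group1 <[X]>) (cycle_id Y); rewrite mul1g defQ.
have [x nx Gx def_X] := morphimP QX; have [y ny Gy def_Y] := morphimP QY.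
set H := <[x]> <*> <[y]>.
have sHG : H \subset G by rewrite join_subG !cycle_subG Gx.
have defG : G^`(1) * H = G.
  apply/eqP; rewrite eqEsubset mul_subG ?der_sub //=.
  rewrite -quotientSK // -defQ mul_subG // cycle_subG ?def_X ?def_Y.
    by rewrite mem_quotient // /H (subsetP (joing_subl _ _)) ?cycle_id.
  by rewrite mem_quotient // /H (subsetP (joing_subr _ _)) ?cycle_id.
have cG'G : G^`(1) \subset 'C(G) by rewrite (subset_trans sG'Z) ?subsetIr.
have nHG : G \subset 'N(H).
  by rewrite -defG mul_subG ?normG // cents_norm // (subset_trans cG'G) ?centS.
have sG'H : G^`(1) \subset H.
  apply: der1_min => //; rewrite -defG quotientMidr quotient_abelian //.
  by rewrite /abelian (subset_trans cG'G) // centS ?der_sub.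
have {}defG : H = G by rewrite -defG; apply/esym/mulSGid.
have zG' : [~ x, y] \in G^`(1) by rewrite mem_commg.
have defG' : G^`(1) = <[[~ x, y]]>.
  by rewrite -{1}defG der1_joing_cycles // (subsetP (centS sHG)) ?(subsetP cG'G).
set m := #[Y]; pose r := #[X] %/ m; set k := #[[~ x, y]].
have rm : (r * m = #[X])%N by rewrite divnK.
have oG : #|G| = (r * m * m * k)%N.
  rewrite rm -oQ card_quotient ?der_norm // /k orderE -defG'.
  by rewrite mulnC Lagrange ?der_sub.
have powG' g i : g \in G -> (coset G^`(1) g ^+ i == 1) = (g ^+ i \in <[[~ x, y]]>).
  move=> Gg; have ng := subsetP nG'G g Gg; rewrite -morphX // -defG'.
  by apply/eqP/idP; [apply: coset_idr; rewrite groupX | apply: coset_id].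
have xrm : x ^+ (r * m) \in <[[~ x, y]]>.
  by rewrite -powG' // rm -order_dvdn def_X.
have ym : y ^+ m \in <[[~ x, y]]> by rewrite -powG' // -order_dvdn /m def_Y.
have centz g : g \in G -> commute [~ x, y] g.
  by move=> Gg; apply: (centP (subsetP cG'G _ zG')).
(* The [m]-th power of the commutator is the commutator of [x] with [y ^+ m], which is central. *)
have dvd_km : k %| m.
  rewrite order_dvdn -commgX; last exact/commute_sym/centz.
  apply/commgP/commute_sym/(centP (subsetP cG'G _ _)) => //.
  by rewrite defG'.
have [i def_xrm] := cycleP _ _ xrm; have [j def_ym] := cycleP _ _ ym.
have twistK n : [~ x, y] ^+ (n + 'C(r * m, 2) + 'C(r * m, 2)) = [~ x, y] ^+ n.
  rewrite -addnA addnn -mul2n expgD [X in _ * X](_ : _ = 1) ?mulg1 //.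
  by apply/eqP; rewrite -order_dvdn twist2.
(* Shifting the actual exponents [i] and [j] by [T] cancels the offset in [hpair], because [k]
   divides [2 * T]. *)
exists m, r, k, (i + 'C(r * m, 2))%N, (j + 'C(r * m, 2))%N, x, y; split=> //.
apply/and5P; split; rewrite ?twistK ?def_xrm ?def_ym //; first exact/eqP.
by rewrite (subsetP cG'G).
Qed.

(** * A model group for each choice of parameters *)

Section Hub.

Variables (m r k I J : nat).
Hypotheses (m_gt0 : 0 < m) (r_gt0 : 0 < r) (k_gt0 : 0 < k) (dvd_km : k %| m).

Let T := 'C(r * m, 2).

Lemma nform_mod (gT : finGroupType) (G : {group gT}) (x y : gT) b a c :
    hpair m r k G I J x y ->
  nform x y b a c = nform x y (b %% m) (a %% (r * m))
    ((c + (I + T) * (a %/ (r * m)) + (J + T) * (b %/ m)) %% k).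
Proof.
move=> xyG; have [_ cent_z _ /eqP xm /eqP ym] := and5P xyG.
have [Gx Gy] := hpair_mem xyG.
rewrite /nform -[in RHS](hpair_order xyG) expg_mod_order.
have -> : y ^+ b = y ^+ (b %% m) * [~ x, y] ^+ ((J + T) * (b %/ m)).
  rewrite {1}(divn_eq b m) addnC (mulnC (b %/ m)).
  by rewrite expgD [y ^+ (_ * _)]expgM ym -expgM.
have -> : x ^+ a = x ^+ (a %% (r * m)) * [~ x, y] ^+ ((I + T) * (a %/ (r * m))).
  rewrite {1}(divn_eq a (r * m)) addnC (mulnC (a %/ _)).
  by rewrite expgD [x ^+ (_ * _)]expgM xm -expgM.
rewrite -!mulgA; congr (_ * _).
rewrite mulgA -(commuteX2 _ _ (commute_x_commg (hpair_cent xyG))) -mulgA; congr (_ * _).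
by rewrite -!expgD; congr (_ ^+ _); lia.
Qed.

(** Groups with the same parameters are compared through one concrete group. Sending its normal
    forms to those of [G] is well defined by [nform_mod], multiplicative and onto, hence bijective
    by equality of orders. *)
Lemma hpair_hub : exists hT : finGroupType,
  [/\ #|hT| = (r * m * m * k)%N,
      exists x y : hT, hpair m r k [set: hT] I J x y &
      forall (gT : finGroupType) (G : {group gT}) (x y : gT),
        hpair m r k G I J x y -> #|G| = (r * m * m * k)%N -> [set: hT] \isog G].
Proof.
have rm_gt0 : 0 < r * m by rewrite muln_gt0 r_gt0.
have dvd_krm : k %| r * m by rewrite dvdn_mull.
have [hT [f [co [oT coK fM feq]]]] :=
    @model_exists (r * m) m k (I + T) (J + T) rm_gt0 m_gt0 k_gt0 dvd_krm dvd_km.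
have f0 : f 0 0 0 = 1.
  by apply: (mulgI (f 0 0 0)); rewrite fM mulg1.
pose x := f 0 1%N 0; pose y := f 1%N 0 0; pose z := f 0 0 1%N.
have fX a : x ^+ a = f 0 a 0.
  by elim: a => [|a IHa]; rewrite ?expg0 ?f0 // expgS IHa fM.
have fY b : y ^+ b = f b 0 0.
  by elim: b => [|b IHb]; rewrite ?expg0 ?f0 // expgS IHb fM.
have fZ c : z ^+ c = f 0 0 c.
  by elim: c => [|c IHc]; rewrite ?expg0 ?f0 // expgS IHc fM !addn0.
have def_z : [~ x, y] = z.
  apply: (mulgI (y * x)); rewrite -commgC !fM; apply/feq.
  by split; rewrite ?muln0 ?addn0.
have fE b a c : f b a c = nform x y b a c.
  by rewrite /nform def_z fX fY fZ !fM !(add0n, addn0, mul0n, muln0).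
exists hT; split=> //.
  exists x, y; apply/and5P; split.
  - rewrite eqEsubset subsetT; apply/subsetP=> t _; rewrite (coK t) fE.
    have /andP[xW yW] := mem_joing_cycles x y.
    by rewrite !groupM ?groupX ?groupR.
  - apply/centP=> t _; rewrite def_z (coK t) /commute !fM.
    by rewrite !(add0n, addn0, mul0n, muln0) addnC.
  - rewrite def_z eqn_dvd order_dvdn fZ -f0; apply/andP; split.
      apply/eqP/feq; split=> //; rewrite !div0n !muln0 !addn0 modnn mod0n //.
    have /feq[_ _] : f 0 0 #[z] = f 0 0 0 by rewrite -fZ expg_order f0.
    by rewrite !div0n !muln0 !addn0 mod0n => /eqP.
  - rewrite fX def_z fZ; apply/eqP/feq; split; rewrite ?modnn ?mod0n //.
    by rewrite !div0n divnn rm_gt0 muln1 !muln0 !addn0.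
  rewrite fY def_z fZ; apply/eqP/feq; split; rewrite ?modnn ?mod0n //.
  by rewrite !div0n divnn m_gt0 muln1 !muln0 !addn0.
move=> gT G u v uvG oG.
pose phi t := nform u v (co t).1.1 (co t).1.2 (co t).2.
have phi_f b a c : phi (f b a c) = nform u v b a c.
  rewrite /phi; have := coK (f b a c).
  move: (co _) => [[b' a'] c'] /= /esym/feq[ea eb ec].
  by rewrite (nform_mod _ _ _ uvG) (nform_mod b a c uvG) ea eb ec.
have phiM : {in [set: hT] &, {morph phi : s t / s * t}}.
  move=> s t _ _; rewrite (coK s) (coK t) fM !phi_f.
  by rewrite (nform_mul (hpair_cent uvG)).
pose phim := Morphism phiM.
have im_phi : phim @* [set: hT] = G.
  apply/setP=> g; apply/morphimP/idP => [[t _ _ ->]|].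
    by apply/(hpairP uvG); exists (co t).1.1, (co t).1.2, (co t).2.
  by case/(hpairP uvG) => b [a [c ->]]; exists (f b a c); rewrite ?inE //= phi_f.
rewrite -[G : {set gT}]im_phi; apply: sub_isog => //.
by rewrite -card_im_injm im_phi cardsT oT oG.
Qed.

End Hub.

(** * The five-parameter type of a group *)

Lemma hpair_injm (aT rT : finGroupType) (D G : {group aT})
    (f : {morphism D >-> rT}) m r k I J x y :
  'injm f -> G \subset D -> hpair m r k G I J x y ->
  hpair m r k (f @* G) I J (f x) (f y).
Proof.
move=> injf sGD xyG; have [Gx Gy] := hpair_mem xyG.
have [Dx Dy] := (subsetP sGD x Gx, subsetP sGD y Gy).
have [/eqP defG cent_z oz /eqP xm /eqP ym] := and5P xyG.
have Dz : [~ x, y] \in D by rewrite groupR.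
apply/and5P; rewrite -morphR //; split.
- by rewrite -!morphim_cycle // -morphimY ?cycle_subG // defG.
- apply/centP=> _ /morphimP[g Dg Gg ->].
  by rewrite /commute -!morphM // (centP cent_z).
- by rewrite order_injm.
- by rewrite -!morphX // xm.
- by rewrite -!morphX // ym.
Qed.

Lemma hpair_in_Ncd (gT : finGroupType) (G : {group gT}) m r k I J x y :
  hpair m r k G I J x y -> in_Ncd 2 2 G.
Proof.
move=> xyG; have [Gx Gy] := hpair_mem xyG.
have [/eqP defG cent_z _ _ _] := and5P xyG.
have sG'Z : G^`(1) \subset 'Z(G).
  by rewrite (hpair_der1 xyG) cycle_subG inE groupR.
apply/and3P; split.
- by rewrite -quotient_center_nil abelian_nil // sub_der1_abelian.
- by rewrite nil_class2.
have <- : <<[set x; y]>> = G by rewrite -defG joing_idl joing_idr.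
by rewrite (leq_trans (grank_min _)) // cards2; case: (_ != _).
Qed.

(** Existence of a normal-form pair with [k = c * e * d], [m = b * k] and [r = a * e]. The order is
    bracketed like the Dirichlet product in [gcount_dirichlet]. *)
Definition htype (a b c d e : nat) (gT : finGroupType) (G : {set gT}) :=
  (#|G| == (a * b ^ 2 * (c ^ 3 * d ^ 3) * e ^ 4)%N) &&
  [exists x, exists y, hpair (b * (c * e * d)) (a * e) (c * e * d) G (c * e) c x y].

Section HType.

Variables (gT : finGroupType) (G : {group gT}).

Lemma htype_cardE (a b c d e : nat) : (a * b ^ 2 * (c ^ 3 * d ^ 3) * e ^ 4 =
  a * e * (b * (c * e * d)) * (b * (c * e * d)) * (c * e * d))%N.
Proof. lia. Qed.

Lemma htypeP a b c d e : reflect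
  ((exists x y, hpair (b * (c * e * d)) (a * e) (c * e * d) G (c * e) c x y) /\
   #|G| = (a * e * (b * (c * e * d)) * (b * (c * e * d)) * (c * e * d))%N)
  (htype a b c d e G).
Proof.
rewrite /htype htype_cardE; apply: (iffP andP) => [[/eqP oG]|[[x [y xyG]] oG]].
  by case/existsP=> x /existsP[y xyG]; split=> //; exists x, y.
by split; [apply/eqP | apply/existsP; exists x; apply/existsP; exists y].
Qed.

Lemma htype_exists : in_Ncd 2 2 G -> exists a b c d e, htype a b c d e G.
Proof.
case/and3P=> nilG cl2 rk2.
have [m [r [k [I [J [x [y [/dvdnP[b def_m] xyG oG]]]]]]]] := hpair_exists nilG cl2 rk2.
have k_gt0 : 0 < k by rewrite -(hpair_order xyG) order_gt0.
have dvd_km : k %| m by rewrite def_m dvdn_mull.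
have [c [e [x' [y' [/dvdnP[a def_r] /dvdnP[d def_k] xyG']]]]] :=
  hpair_normal_form dvd_km k_gt0 xyG.
exists a, b, c, d, e; apply/htypeP.
have -> : (c * e * d = k)%N by rewrite def_k mulnC.
by rewrite -def_m -def_r; split=> //; exists x', y'.
Qed.

Lemma htype_gt0 a b c d e : htype a b c d e G ->
  [/\ 0 < a, 0 < b, 0 < c, 0 < d & 0 < e].
Proof.
case/andP=> /eqP oG _; have := cardG_gt0 G; rewrite oG htype_cardE !muln_gt0.
by case/andP=> /andP[/andP[/andP[-> ->] /andP[-> /andP[/andP[-> _] ->]]] _] _.
Qed.

(** One direction of the comparison; [htype_inj] applies it both ways and concludes by antisymmetry
    of divisibility. *)
Lemma htype_dvdn a b c d e a' b' c' d' e' :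
    htype a b c d e G -> htype a' b' c' d' e' G ->
  [/\ a * e = a' * e', b = b', c * e * d = c' * e' * d', c %| c' & c * e %| c' * e']%N.
Proof.
move=> tG tG'; have [_ _ c0 d0 e0] := htype_gt0 tG.
have k_gt0 : 0 < c * e * d by rewrite !muln_gt0 c0 e0.
have [[x [y xyG]] oG] := htypeP _ _ _ _ _ tG.
have [[x' [y' xyG']] oG'] := htypeP _ _ _ _ _ tG'.
have [eq_k eq_m eq_r] := hpair_params_inj oG oG' xyG xyG'.
have dvd_km : c * e * d %| b * (c * e * d) by rewrite dvdn_mull.
rewrite -eq_m -eq_r -eq_k in xyG' oG'.
have inv := hpair_invariant dvd_km k_gt0 oG xyG xyG'.
split=> //.
- by move/eqP: eq_m; rewrite -eq_k eqn_pmul2r // => /eqP.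
- by have [||->] // := inv c; rewrite -?mulnA dvdn_mulr.
have [||_ ->] // := inv (c * e)%N; first by rewrite dvdn_mulr.
by rewrite -mulnA dvdn_mull // mulnC.
Qed.

Lemma htype_inj a b c d e a' b' c' d' e' :
    htype a b c d e G -> htype a' b' c' d' e' G ->
  [/\ a = a', b = b', c = c', d = d' & e = e'].
Proof.
move=> tG tG'; have [_ _ c0 d0 e0] := htype_gt0 tG.
have [eq_r eq_b eq_k dvd_c dvd_ce] := htype_dvdn tG tG'.
have [_ _ _ dvd_c' dvd_ce'] := htype_dvdn tG' tG.
have /eqP eq_c : c == c' by rewrite eqn_dvd dvd_c.
have /eqP eq_ce : (c * e == c' * e')%N by rewrite eqn_dvd dvd_ce.
have eq_e : e = e'.
  by move/eqP: eq_ce; rewrite -eq_c eqn_pmul2l // => /eqP.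
split=> //.
  by move/eqP: eq_r; rewrite -eq_e eqn_pmul2r // => /eqP.
by move/eqP: eq_k; rewrite -eq_c -eq_e eqn_pmul2l ?muln_gt0 ?c0 // => /eqP.
Qed.

Lemma htype_in_Ncd a b c d e : htype a b c d e G -> in_Ncd 2 2 G.
Proof. by case/htypeP=> [[x [y xyG]] _]; apply: hpair_in_Ncd xyG. Qed.

End HType.

Lemma isog_htype (gT rT : finGroupType) (G : {group gT}) (H : {group rT}) a b c d e :
  G \isog H -> htype a b c d e G -> htype a b c d e H.
Proof.
move=> isoGH /htypeP[[x [y xyG]] oG]; apply/htypeP; rewrite -(card_isog isoGH).
split=> //; have [f injf <-] := isogP isoGH.
by exists (f x), (f y); apply: hpair_injm.
Qed.

Lemma htype_model (a b c d e : nat) : 0 < a -> 0 < b -> 0 < c -> 0 < d -> 0 < e ->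
  exists hT : finGroupType, htype a b c d e [set: hT] /\
    forall (gT : finGroupType) (G : {group gT}), htype a b c d e G -> [set: hT] \isog G.
Proof.
move=> a0 b0 c0 d0 e0.
have k_gt0 : 0 < c * e * d by rewrite !muln_gt0 c0 e0.
have m_gt0 : 0 < b * (c * e * d) by rewrite muln_gt0 b0.
have r_gt0 : 0 < a * e by rewrite muln_gt0 a0.
have dvd_km : c * e * d %| b * (c * e * d) by rewrite dvdn_mull.
have [hT [oT [x [y xyT]] isoT]] := hpair_hub (c * e) c m_gt0 r_gt0 k_gt0 dvd_km.
exists hT; split=> [|gT G /htypeP[[x' [y' xyG]] oG]]; last exact: isoT xyG oG.
by apply/(htypeP [set: hT]%G); rewrite /= cardsT oT; split=> //; exists x, y.
Qed.

End ClassTwo.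

(** * Counting isomorphism classes *)

Section Weights.

Variable N : nat.

(** A coefficient is read as the number of points of a given weight. The cutoff [N] lets finite
    index types suffice, and Dirichlet products become products of index types. *)
Definition counts_weights (f : nat -> nat) (I : finType) (w : I -> nat) :=
  forall n, 0 < n <= N -> f n = #|[pred i | w i == n]|.

Lemma counts_ddil k : 0 < k ->
  counts_weights (ddil k dzeta) (fun i : 'I_N.+1 => i ^ k).
Proof.
move=> k_gt0 n /andP[n_gt0 n_le]; rewrite /ddil -sum1_card.
rewrite -(big_mkord (fun i => i ^ k == n) (fun=> 1)) [RHS]big_ltn_cond //.
(* The index 0 has weight 0, which is excluded by [0 < n]; any other index of weight [n] is at most
   [n]. *)
rewrite exp0n // ltn_eqF //= (big_nat_widen 1 n.+1 N.+1) //.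
apply: eq_bigl => -[|i]; first by rewrite exp0n // ltn_eqF.
by rewrite ltnS; case: eqP => //= <-; rewrite -[in X in X <= _](expn1 i.+1) leq_pexp2l.
Qed.

Lemma counts_dmul f g (I J : finType) (w : I -> nat) (v : J -> nat) :
    counts_weights f w -> counts_weights g v ->
  counts_weights (dmul f g) (fun ij : I * J => w ij.1 * v ij.2).
Proof.
move=> fw gv n /andP[n_gt0 n_le]; rewrite /dmul -sum1_card.
(* The inner sum equals 1; it records the divisor [m = w ij.1], by which the pairs are then
   sorted. *)
have -> : \sum_(ij in [pred ij : I * J | w ij.1 * v ij.2 == n]) 1 =
    \sum_(ij : I * J | w ij.1 * v ij.2 == n) \sum_(m <- divisors n | m == w ij.1) 1.
  apply: eq_bigr => -[i j] /= /eqP wv.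
  rewrite -big_filter filter_pred1_uniq ?divisors_uniq ?big_seq1 //.
  by rewrite -dvdn_divisors // -wv dvdn_mulr.
rewrite (exchange_big_dep predT) //= big_seq [RHS]big_seq.
apply: eq_bigr => m; rewrite -dvdn_divisors // => dvd_mn.
have m_gt0 := dvdn_gt0 n_gt0 dvd_mn.
have m_le : m <= n := dvdn_leq n_gt0 dvd_mn.
have d_gt0 : 0 < n %/ m by rewrite divn_gt0.
have d_le : n %/ m <= N := leq_trans (leq_div n m) n_le.
rewrite fw ?m_gt0 ?(leq_trans m_le) // gv ?d_gt0 ?d_le //.
rewrite -cardX -sum1_card; apply: eq_bigl => -[i j]; rewrite !inE /=.
rewrite ?andbT [m == _]eq_sym; have [->|] := eqVneq (w i) m; rewrite ?andbF //.
by rewrite andbT eqn_div // eq_sym mulnC eq_sym.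
Qed.

End Weights.

Lemma htype_isog (gT rT : finGroupType) (G : {group gT}) (H : {group rT}) a b c d e :
  htype a b c d e G -> htype a b c d e H -> G \isog H.
Proof.
move=> tG tH; have [a0 b0 c0 d0 e0] := htype_gt0 tG.
have [hT [_ isoT]] := htype_model a0 b0 c0 d0 e0.
by apply: isog_trans (isoT _ _ tH); rewrite isog_sym; apply: isoT.
Qed.

(** The type is a complete isomorphism invariant, so [F] is a bijection from the tuples of weight
    [n] onto the isomorphism classes. *)
Lemma gcount_weights n : 0 < n -> gcount n 2 2 =
  #|[pred t : 'I_n.+1 * 'I_n.+1 * ('I_n.+1 * 'I_n.+1) * 'I_n.+1 |
      t.1.1.1 ^ 1 * t.1.1.2 ^ 2 * (t.1.2.1 ^ 3 * t.1.2.2 ^ 3) * t.2 ^ 4 == n]|.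
Proof.
move=> n_gt0; set w := (X in #|X|).
pose I := 'I_n.+1; pose ht (t : I * I * (I * I) * I) (gT : finGroupType) :=
  @htype t.1.1.1 t.1.1.2 t.1.2.1 t.1.2.2 t.2 gT.
pose F t := [set H : {group 'S_n} | ht t _ H].
have wE t (gT : finGroupType) (G : {group gT}) : ht t _ G -> (t \in w) = (#|G| == n).
  by case/andP=> /eqP-> _; rewrite inE /= expn1.
have class_F t (K : {group 'S_n}) : t \in w -> ht t _ K ->
    [set H in Ncd_subgroups n 2 2 | K \isog H] = F t.
  move=> tw tK; apply/setP=> H; rewrite !inE; apply/andP/idP => [[_ isoKH]|tH].
    exact: isog_htype isoKH tK.
  by rewrite -(wE _ _ _ tH) tw (htype_in_Ncd tH) (htype_isog tK tH).
(* The model group of type [t] has order [n], so Cayley's theorem places a copy of it in ['S_n]. *)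
have F_wit t : t \in w -> exists K : {group 'S_n}, ht t _ K.
  move=> tw; have : 0 < t.1.1.1 * t.1.1.2 ^ 2 * (t.1.2.1 ^ 3 * t.1.2.2 ^ 3) * t.2 ^ 4.
    by move: tw; rewrite inE /= expn1 => /eqP->.
  rewrite htype_cardE !muln_gt0.
  case/andP=> /andP[/andP[/andP[a0 e0] /andP[b0 /andP[/andP[c0 _] d0]]] _] _.
  have [hT [tT _]] := htype_model a0 b0 c0 d0 e0.
  have [K isoK] : exists K : {group 'S_n}, [set: hT] \isog K.
    by have := wE t hT [set: hT]%G tT; rewrite tw => /esym/eqP <-; apply: cayley.
  by exists K; apply: isog_htype isoK tT.
rewrite /gcount; have -> : isoclasses n 2 2 = F @: [set t in w].
  apply/setP=> B; apply/imsetP/imsetP => [[K]|[t]]; last first.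
    rewrite inE => tw ->; have [K tK] := F_wit t tw; exists K.
      by rewrite inE -(wE _ _ _ tK) tw (htype_in_Ncd tK).
    by rewrite (class_F t).
  rewrite inE => /andP[/eqP oK NK] ->.
  have [a [b [c [d [e tK]]]]] := htype_exists NK.
  have [a0 b0 c0 d0 e0] := htype_gt0 tK.
  (* Each of the five parameters divides the order [n] and so fits in the index type. *)
  have le_n i : i %| #|K| -> i < n.+1 by move/dvdn_leq; rewrite oK ltnS; apply.
  have oKE : #|K| = a * b ^ 2 * (c ^ 3 * d ^ 3) * e ^ 4 by case/andP: tK => /eqP.
  pose t : I * I * (I * I) * I :=
    (inord a, inord b, (inord c, inord d), inord e).
  have tK' : ht t _ K.
    rewrite /ht /t /= !inordK //; apply: le_n; rewrite oKE.
    - by rewrite dvdn_mull // expnS dvdn_mulr.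
    - by rewrite dvdn_mulr // dvdn_mull // dvdn_mull // expnS dvdn_mulr.
    - by rewrite dvdn_mulr // dvdn_mull // dvdn_mulr // expnS dvdn_mulr.
    - by rewrite dvdn_mulr // dvdn_mulr // dvdn_mull // expnS dvdn_mulr.
    by rewrite dvdn_mulr // dvdn_mulr // dvdn_mulr.
  have tw : t \in w by rewrite (wE _ _ _ tK') oK.
  by exists t; rewrite ?inE // -(class_F t K).
(* A subgroup lying in both [F s] and [F t] has both types, which forces [s = t]. *)
rewrite card_in_imset ?cardsE // => s t; rewrite !inE => sw tw /setP eqF.
have [K sK] := F_wit s sw; have := eqF K; rewrite !inE sK => /esym tK.
have [] := htype_inj sK tK; case: s t {sw tw eqF sK tK} => [[[s1 s2] [s3 s4]] s5].
case=> [[[t1 t2] [t3 t4]] t5] /= e1 e2 e3 e4 e5.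
by congr (_, _, (_, _), _); apply: val_inj.
Qed.

Lemma gcount_dirichlet n : 0 < n -> gcount n 2 2 =
  (dzeta * ddil 2 dzeta * (ddil 3 dzeta * ddil 3 dzeta) * ddil 4 dzeta)%D n.
Proof.
move=> n_gt0; rewrite gcount_weights //; symmetry.
have count_dzeta : counts_weights n dzeta (fun i : 'I_n.+1 => i ^ 1).
  move=> m /andP[_ m_le]; rewrite -[LHS](card1 (inord m : 'I_n.+1)).
  by apply: eq_card => i; rewrite !inE expn1 -val_eqE /= inordK.
have count_ddil k := @counts_ddil n k.
have C := counts_dmul (counts_dmul (counts_dmul count_dzeta (count_ddil 2 isT))
  (counts_dmul (count_ddil 3 isT) (count_ddil 3 isT))) (count_ddil 4 isT).
by rewrite C ?n_gt0 ?leqnn.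
Qed.

(** * Products of Dirichlet series *)

From mathcomp Require Import complex.
From mathcomp Require Import all_classical all_reals all_analysis.
From mathcomp Require Import lra ring.
Import Order.TTheory GRing.Theory Num.Theory.
Import numFieldNormedType.Exports.
Local Open Scope ring_scope.

Section Analysis.

Local Open Scope classical_set_scope.
Local Open Scope complex_scope.

(** * Limits of complex sequences *)

Section ComplexSequences.

Variable R : realType.
Implicit Types (u v : nat -> R[i]) (e p q : nat -> R).

Lemma normc_le (x y : R) : `|x +i* y| <= (`|x| + `|y|)%:C.
Proof.
rewrite normc_def lecR /= -[leRHS]ger0_norm ?addr_ge0 // -sqrtr_sqr.
rewrite ler_sqrt ?sqr_ge0 // sqrrD !real_normK ?num_real //.
by rewrite lerD2r lerDl mulrn_wge0 // mulr_ge0.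
Qed.

Lemma cvgc_dominated u (l : R[i]) e : (forall n, `|l - u n| <= (e n)%:C) ->
  e n @[n --> \oo] --> 0 -> (u n : R[i]^o) @[n --> \oo] --> (l : R[i]^o).
Proof.
move=> ule e0; apply/cvgrPdist_lt => eps eps_gt0.
(* A positive element for the order on [R[i]] is real, so the tolerance can be handed to the real
   sequence [e]. *)
have /andP[/eqP Im_eps Re_eps] : (complex.Im eps == 0) && (0 < complex.Re eps).
  by move: eps_gt0; rewrite ltcE /=.
have epsE : eps = (complex.Re eps)%:C by case: eps Im_eps {eps_gt0 Re_eps} => a b /= ->.
move/cvgrPdist_lt : e0 => /(_ _ Re_eps) [N _ eN].
exists N => // n Nn; apply: le_lt_trans (ule n) _.
rewrite epsE ltcR; apply: le_lt_trans (eN n Nn).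
by rewrite sub0r normrN ler_norm.
Qed.

Lemma cvgc_split u :
  cvgn (fun n => complex.Re (u n)) -> cvgn (fun n => complex.Im (u n)) ->
  cvgn (u : nat -> R[i]^o).
Proof.
move=> /cvg_ex[x ux] /cvg_ex[y uy]; apply/cvg_ex; exists (x +i* y).
have dist0 (w : nat -> R) (c : R) : w n @[n --> \oo] --> c ->
    `|c - w n| @[n --> \oo] --> 0.
  move/cvgrPdist_lt => wc; apply/cvgr0Pnorm_lt => /= eps /wc.
  by apply: filterS => n; rewrite normr_id.
pose e n := `|x - complex.Re (u n)| + `|y - complex.Im (u n)|.
apply: (@cvgc_dominated _ _ e) => [n|].
  by rewrite /e; case: (u n) => a b; apply: normc_le.
by rewrite -(addr0 0); apply: cvgD; apply: dist0.
Qed.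

(* [q] is squeezed between [p] and one of its own subsequences, so both have
   the same limit. *)
Lemma cvgc_truncation u v p q (theta : nat -> nat) (l : R[i]) :
    (forall n, `|u n - v n| <= (p n - q n)%:C) ->
    {homo q : m n / (m <= n)%N >-> m <= n} ->
    (forall n, q n <= p n) -> (forall n, p n <= q (theta n)) ->
    (forall n, (n <= theta n)%N) -> cvgn p ->
    (u n : R[i]^o) @[n --> \oo] --> (l : R[i]^o) ->
  cvgn q /\ (v n : R[i]^o) @[n --> \oo] --> (l : R[i]^o).
Proof.
move=> uv q_homo qp pq theta_ge /cvg_ex[h ph] ul.
have q_cvg : cvgn q.
  apply: nondecreasing_is_cvgn => //.
  have /cvg_seq_bounded[M [_ pM]] : cvgn p by apply/cvg_ex; exists h.
  exists (M + 1) => _ [n _ <-]; apply: le_trans (qp n) _.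
  by rewrite (le_trans (ler_norm _)) ?pM ?ltrDl.
split=> //.
have qtheta : q (theta n) @[n --> \oo] --> limn q.
  apply: (cvg_comp theta q _ q_cvg) => A [N _ NA].
  by exists N => // n Nn; apply: NA; apply: leq_trans (theta_ge n).
have p_lim : p n @[n --> \oo] --> limn q.
  apply: (squeeze_cvgr _ q_cvg qtheta).
  by apply: nearW => n; rewrite qp pq.
have pq0 : p n - q n @[n --> \oo] --> 0.
  by rewrite -(subrr (limn q)); apply: cvgB.
have vu : (u n - v n : R[i]^o) @[n --> \oo] --> (0 : R[i]^o).
  by apply: cvgc_dominated pq0 => n; rewrite sub0r normrN.
apply/cvgrPdist_lt => eps eps_gt0; have eps2_gt0 : 0 < eps / 2 by rewrite divr_gt0.
move/cvgrPdist_lt : ul => /(_ _ eps2_gt0) ul.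
move/cvgrPdist_lt : vu => /(_ _ eps2_gt0) vu; apply: filterS2 ul vu => n lu_n.
rewrite sub0r normrN => uv_n; rewrite [eps]splitr -(subrKA (u n)).
exact: le_lt_trans (ler_normD _ _) (ltrD lu_n uv_n).
Qed.

End ComplexSequences.

(** One box of side [N] serves all [n] up to [N], so that a sum over [n] can be exchanged with those
    over the factors. *)
Lemma dmul_box (f g : nat -> nat) (n N : nat) : (0 < n <= N)%N ->
  dmul f g n = (\sum_(1 <= i < N.+1) \sum_(1 <= j < N.+1 | i * j == n) f i * g j)%N.
Proof.
case/andP=> n_gt0 n_le; rewrite /dmul.
have perm_div : perm_eq (divisors n) [seq i <- index_iota 1 N.+1 | (i %| n)%N].
  apply: uniq_perm; rewrite ?divisors_uniq ?filter_uniq ?iota_uniq // => i.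
  rewrite mem_filter mem_index_iota -dvdn_divisors //.
  have [dvd_in|//] := boolP (i %| n)%N.
  by rewrite (dvdn_gt0 n_gt0) //= ltnS (leq_trans (dvdn_leq _ dvd_in)).
rewrite (perm_big _ perm_div) /= big_filter big_mkcond /= big_nat [RHS]big_nat.
apply: eq_bigr => i /andP[i_gt0 _].
have [dvd_in|Ndvd] := boolP (i %| n)%N; last first.
  rewrite big1 // => j /eqP def_n; case/negP: Ndvd; by rewrite -def_n dvdn_mulr.
rewrite (eq_bigl (pred1 (n %/ i)%N)) => [|j]; last first.
  by rewrite /= -[RHS](eqn_pmul2l i_gt0) [(i * (n %/ i))%N]mulnC divnK.
rewrite -big_filter filter_pred1_uniq ?iota_uniq ?big_seq1 //.
have i_le : (i <= n)%N := dvdn_leq n_gt0 dvd_in.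
have d_le := leq_trans (leq_div n i) n_le.
by rewrite mem_index_iota divn_gt0 // i_le ltnS.
Qed.

Lemma big_pred1_box (V : nmodType) (F : V) (m N : nat) : (0 < m)%N ->
  \sum_(1 <= n < N.+1 | m == n) F = if (m <= N)%N then F else 0.
Proof.
move=> m_gt0; case: leqP => [m_le|m_gt].
  rewrite -big_filter (eq_filter (a2 := pred1 m)) => [|n]; last exact: eq_sym.
  by rewrite filter_pred1_uniq ?iota_uniq ?big_seq1 // mem_index_iota m_gt0.
rewrite big_nat_cond big1 // => n /andP[/andP[_ n_le] /eqP eq_mn].
by move: m_gt n_le; rewrite eq_mn ltnS => /ltn_geF->.
Qed.

(** * Partial sums with a multiplicative weight *)

Section Sums.

Variables (X : comNzRingType) (chi : nat -> X).
Hypothesis chiM : forall m n, (0 < m)%N -> (0 < n)%N -> chi (m * n)%N = chi m * chi n.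

(** Ring and weight are left open so that the complex series and the series of its absolute values
    share the same rearrangements. *)
Definition dsum (a : nat -> nat) (N : nat) : X :=
  \sum_(1 <= n < N.+1) (a n)%:R * chi n.

Lemma dsum_dmul a b N : dsum (dmul a b) N =
  \sum_(1 <= i < N.+1) \sum_(1 <= j < N.+1 | (i * j <= N)%N)
    ((a i)%:R * chi i) * ((b j)%:R * chi j).
Proof.
rewrite /dsum big_nat.
under eq_bigr => n n_bd.
  rewrite (dmul_box a b n_bd) natr_sum mulr_suml.
  under eq_bigr => i _ do rewrite natr_sum mulr_suml.
  over.
rewrite -big_nat exchange_big /= big_nat [RHS]big_nat.
apply: eq_bigr => i /andP[i_gt0 _].
rewrite (exchange_big_dep predT) //= big_nat [RHS]big_nat_cond [RHS]big_mkcondr /=.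
apply: eq_bigr => j /andP[j_gt0 _].
rewrite -(big_pred1_box _ _ (m := (i * j)%N)) ?muln_gt0 ?i_gt0 //.
apply: eq_bigr => n /eqP <-.
by rewrite chiM // natrM mulrACA.
Qed.

Lemma dsum_ddil k N : (0 < k)%N -> dsum (ddil k dzeta) N =
  \sum_(1 <= m < N.+1 | (m ^ k <= N)%N) chi (m ^ k)%N.
Proof.
move=> k_gt0; rewrite /dsum.
transitivity (\sum_(1 <= n < N.+1) \sum_(1 <= m < N.+1 | (m ^ k == n)%N) chi n).
  apply: eq_big_nat => n /andP[n_gt0 n_le]; rewrite /ddil natr_sum mulr_suml.
  rewrite (big_nat_widen 1 n.+1 N.+1) // big_nat_cond [RHS]big_nat_cond.
  apply: eq_big => [m|m _]; last by rewrite mul1r.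
  apply: andb_id2l => /andP[m_gt0 _]; rewrite ltnS.
  by case: eqP => //= <-; rewrite -[X in (X <= _)%N]expn1 leq_pexp2l.
rewrite (exchange_big_dep predT) //= big_nat [RHS]big_nat_cond [RHS]big_mkcondr /=.
apply: eq_bigr => m /andP[m_gt0 _].
rewrite -(big_pred1_box _ _ (m := (m ^ k)%N)) ?expn_gt0 ?m_gt0 //.
by apply: eq_bigr => n /eqP <-.
Qed.

End Sums.

(** * Powers and absolute convergence *)

Section Powers.

Variable R : realType.
Implicit Types (s : R[i]) (sigma : R) (m n k : nat).

(** The absolute value of [npowN n s] when [sigma] is the real part of [s], see [norm_npowN]. *)
Definition rpowN sigma n : R := expR (- sigma * ln n%:R).

Lemma rpowN_gt0 sigma n : 0 < rpowN sigma n.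
Proof. exact: expR_gt0. Qed.

Lemma rpowNM sigma m n : (0 < m)%N -> (0 < n)%N ->
  rpowN sigma (m * n) = rpowN sigma m * rpowN sigma n.
Proof.
by move=> m_gt0 n_gt0; rewrite /rpowN natrM lnM ?posrE ?ltr0n // mulrDr expRD.
Qed.

Lemma rpowNX sigma m k : (0 < m)%N ->
  rpowN sigma (m ^ k) = rpowN (k%:R * sigma) m.
Proof.
move=> m_gt0; rewrite /rpowN natrX lnXn ?ltr0n // -mulr_natl.
by congr expR; ring.
Qed.

Lemma rpowN_le sigma m n : 0 <= sigma -> (0 < m)%N -> (m <= n)%N ->
  rpowN sigma n <= rpowN sigma m.
Proof.
move=> sigma_ge0 m_gt0 m_le; rewrite ler_expR !mulNr lerN2 ler_wpM2l //.
by rewrite ler_ln ?posrE ?ltr0n ?(leq_trans m_gt0) // ler_nat.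
Qed.

Lemma cexpD (z w : R[i]) : cexp (z + w) = cexp z * cexp w.
Proof.
rewrite /cexp; case: z w => [a b] [c d] /=.
rewrite expRD cosD sinD rmorphM /= mulrACA; congr (_ * _).
by simpc; congr (_ +i* _); ring.
Qed.

Lemma norm_cexp (z : R[i]) : `|cexp z| = (expR (complex.Re z))%:C.
Proof.
rewrite /cexp normrM !normc_def /= expr0n /= addr0 sqrtr_sqr.
by rewrite cos2Dsin2 sqrtr1 mulr1 gtr0_norm ?expR_gt0.
Qed.

Lemma npowNM s m n : (0 < m)%N -> (0 < n)%N ->
  npowN (m * n) s = npowN m s * npowN n s.
Proof.
move=> m_gt0 n_gt0; rewrite /npowN natrM lnM ?posrE ?ltr0n //.
by rewrite rmorphD /= mulrDr cexpD.
Qed.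

Lemma npowNX s m k : (0 < m)%N -> npowN (m ^ k) s = npowN m (k%:R * s).
Proof.
move=> m_gt0; rewrite /npowN natrX lnXn ?ltr0n // rmorphMn /= -mulr_natl.
by congr cexp; ring.
Qed.

Lemma norm_npowN s n : `|npowN n s| = (rpowN (complex.Re s) n)%:C.
Proof.
rewrite norm_cexp /rpowN; congr (expR _)%:C.
by case: s => a b /=; rewrite mulr0 subr0.
Qed.

Lemma Re_natMl s k : complex.Re (k%:R * s) = k%:R * complex.Re s.
Proof.
case: s => a b; rewrite -[k%:R]/((k%:R : R[i])) -(rmorph_nat (real_complex R)) /=.
by rewrite mul0r subr0.
Qed.

Definition rdsum sigma := dsum (rpowN sigma).

Lemma dpartialE a s : dpartial a s = dsum (fun n => npowN n s) a.
Proof. by []. Qed.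

Lemma rdsum_homo sigma a : {homo rdsum sigma a : m n / (m <= n)%N >-> m <= n}.
Proof.
move=> m n m_le; rewrite /rdsum /dsum [leRHS](big_cat_nat _ (n := m.+1)) //=.
by rewrite lerDl sumr_ge0 // => i _; rewrite mulr_ge0 // ltW ?rpowN_gt0.
Qed.

(** Real and imaginary parts are additive and bounded by the modulus, so both component series
    converge absolutely by comparison. *)
Lemma cvg_dpartial a s : cvgn (rdsum (complex.Re s) a) -> cvgn (dpartial a s).
Proof.
pose t n := (a n.+1)%:R * npowN n.+1 s.
have partE N : dpartial a s N = \sum_(0 <= n < N) t n.
  by rewrite /dpartial big_add1.
pose w n := (a n.+1)%:R * rpowN (complex.Re s) n.+1.
have -> : rdsum (complex.Re s) a = series w.
  by apply/funext => N; rewrite /rdsum /dsum big_add1.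
move=> cvg_w; have w_ge0 n : 0 <= w n by rewrite mulr_ge0 // ltW ?rpowN_gt0.
have norm_t n : `|t n| = (w n)%:C.
  by rewrite normrM normr_nat norm_npowN rmorphM rmorph_nat.
have cvg_part (f : R[i] -> R) : {morph f : x y / x + y} -> f 0 = 0 ->
    (forall z, `|f z|%:C <= `|z|) -> cvgn (fun N => f (dpartial a s N)).
  move=> fD f0 f_le.
  have -> : (fun N => f (dpartial a s N)) = series (f \o t).
    by apply/funext => N; rewrite partE (big_morph f fD f0).
  apply: normed_cvg; apply: series_le_cvg cvg_w => // n /=; first exact: normr_ge0.
  by have := f_le (t n); rewrite norm_t lecR.
apply: cvgc_split; apply: cvg_part => //.
- by case=> [? ?] [? ?].
- exact: normc_ge_Re.
- by case=> [? ?] [? ?].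
case=> x y; rewrite normc_def lecR /= -sqrtr_sqr.
by rewrite ler_sqrt ?addr_ge0 ?sqr_ge0 // lerDr sqr_ge0.
Qed.

(* Comparing the terms at [2m] and [2m + 1] with the one at [m] gives
   [S (2N + 1) <= 1 + 2^(1 - sigma) S N]. *)
Lemma cvg_rdsum_dzeta sigma : 1 < sigma -> cvgn (rdsum sigma dzeta).
Proof.
move=> sigma_gt1; have sigma_ge0 : 0 <= sigma by lra.
set S := rdsum sigma dzeta; pose q : R := 2 * rpowN sigma 2.
have q_lt1 : q < 1.
  rewrite /q -{1}[2](@lnK R 2) ?posrE // -expRD expR_lt1.
  have : 0 < ln 2 :> R by rewrite ln_gt0 // ltr1n.
  by nra.
have S_recr N : S N.+1 = S N + rpowN sigma N.+1.
  by rewrite /S /rdsum /dsum big_nat_recr //= mul1r.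
have S_double N : S (2 * N).+1 <= 1 + q * S N.
  elim: N => [|N IHN].
    rewrite S_recr /S /rdsum /dsum !big_nil add0r mulr0 addr0.
    by rewrite /rpowN ln1 mulr0 expR0.
  have rE : rpowN sigma (2 * N.+1) = rpowN sigma 2 * rpowN sigma N.+1 by apply: rpowNM.
  have r_le : rpowN sigma (2 * N.+1).+1 <= rpowN sigma (2 * N.+1) by apply: rpowN_le.
  have e : (2 * N.+1 = (2 * N).+2)%N by rewrite mulnS.
  rewrite e in rE r_le *.
  rewrite (S_recr (2 * N).+2) (S_recr (2 * N).+1) (S_recr N) /q; rewrite /q in IHN.
  by lra.
have S_bound N : S N <= (1 - q)^-1.
  rewrite -[leRHS]mul1r ler_pdivlMr ?subr_gt0 // mulrBr mulr1 lerBlDr.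
  rewrite [S N * q]mulrC (le_trans _ (S_double N)) //.
  by apply: rdsum_homo; lia.
apply: nondecreasing_is_cvgn; first exact: rdsum_homo.
by exists (1 - q)^-1 => _ [N _ <-].
Qed.

End Powers.

(** * Products and dilations of convergent series *)

Section Products.

Variable R : realType.
Implicit Types (s : R[i]) (a b : nat -> nat) (N : nat).

Lemma cvg_dirichlet a s : cvgn (dpartial a s) ->
  dpartial a s N @[N --> \oo] --> (dirichlet a s : R[i]^o).
Proof. by []. Qed.

(** Partial sums of the product run over the region [i * j <= N], products of partial sums over the
    square of side [N]. The square contains that region and is contained in the one for [N * N], so
    [cvgc_truncation] applies with the sums of absolute values as [p] and [q]. *)
Lemma dirichlet_dmul a b s :
    cvgn (rdsum (complex.Re s) a) -> cvgn (rdsum (complex.Re s) b) ->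
  cvgn (rdsum (complex.Re s) (dmul a b)) /\
  dirichlet (dmul a b) s = dirichlet a s * dirichlet b s.
Proof.
set sigma := complex.Re s => cvg_a cvg_b.
pose f i := (a i)%:R * npowN i s; pose g j := (b j)%:R * npowN j s.
pose rf i := (a i)%:R * rpowN sigma i; pose rg j := (b j)%:R * rpowN sigma j.
have rfg_ge0 i j : 0 <= rf i * rg j by rewrite !mulr_ge0 // ltW ?rpowN_gt0.
have norm_fg i j : `|f i * g j| = (rf i * rg j)%:C.
  have norm_term c n : `|c%:R * npowN n s| = (c%:R * rpowN sigma n)%:C.
    by rewrite normrM normr_nat norm_npowN rmorphM rmorph_nat.
  by rewrite normrM !norm_term -rmorphM.
have boxD (X : comNzRingType) (F G : nat -> X) N :
    (\sum_(1 <= i < N.+1) F i) * (\sum_(1 <= j < N.+1) G j) -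
    \sum_(1 <= i < N.+1) \sum_(1 <= j < N.+1 | (i * j <= N)%N) F i * G j =
    \sum_(1 <= i < N.+1) \sum_(1 <= j < N.+1 | ~~ (i * j <= N)%N) F i * G j.
  rewrite mulr_suml -sumrB; apply: eq_bigr => i _.
  by rewrite mulr_sumr [X in X - _](bigID (fun j => i * j <= N)%N) /= [LHS]addrC addKr.
pose p N := rdsum sigma a N * rdsum sigma b N.
pose q := rdsum sigma (dmul a b).
pose u N := dpartial a s N * dpartial b s N.
have qE N := dsum_dmul (@rpowNM R sigma) a b N.
have vE N := dsum_dmul (@npowNM R s) a b N.
have pqE N : p N - q N = \sum_(1 <= i < N.+1)
    \sum_(1 <= j < N.+1 | ~~ (i * j <= N)%N) rf i * rg j.
  by rewrite /q /rdsum qE; apply: boxD.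
have [] := @cvgc_truncation R u (dpartial (dmul a b) s) p q (fun N => N * N)%N
    (dirichlet a s * dirichlet b s).
- move=> N; rewrite pqE dpartialE vE /u !dpartialE boxD.
  rewrite rmorph_sum; apply: le_trans (ler_norm_sum _ _ _) _.
  apply: ler_sum => i _; rewrite rmorph_sum.
  apply: le_trans (ler_norm_sum _ _ _) _.
  by apply: ler_sum => j _; rewrite norm_fg.
- exact: rdsum_homo.
- move=> N; rewrite -subr_ge0 pqE sumr_ge0 // => i _.
  by apply: sumr_ge0 => j _; apply: rfg_ge0.
- move=> N; rewrite /q /rdsum qE /p mulr_suml.
  have N_le : (N.+1 <= (N * N).+1)%N.
    by rewrite ltnS; case: (N) => // n; rewrite leq_pmulr.
  rewrite [leRHS](big_cat_nat _ (n := N.+1)) //= -[leLHS]addr0 lerD //; last first.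
    by rewrite sumr_ge0 // => i _; apply: sumr_ge0 => j _; apply: rfg_ge0.
  rewrite big_nat [leRHS]big_nat; apply: ler_sum => i /andP[_ i_le].
  rewrite mulr_sumr [leRHS](big_cat_nat _ (n := N.+1)) //= -[leLHS]addr0 lerD //.
    rewrite [leRHS]big_nat_cond [leLHS]big_nat le_eqVlt; apply/orP; left; apply/eqP.
    apply: eq_bigl => j; apply/esym/andb_idr => /andP[_ j_le].
    by rewrite leq_mul.
  by apply: sumr_ge0 => j _; apply: rfg_ge0.
- by move=> [|n] //; rewrite leq_pmulr.
- by apply: is_cvgM.
- by apply: cvgM; apply: cvg_dirichlet; apply: cvg_dpartial.
by move=> cvg_q v_lim; split=> //; apply: (cvg_lim _ v_lim); apply: norm_hausdorff.
Qed.

(** The dilated series is the zeta series at [k%:R * s] cut at [m ^ k <= N] instead of [m <= N]; the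
    full cut at [N] reappears at [N ^ k], so [cvgc_truncation] applies again. *)
Lemma dirichlet_ddil k s : (0 < k)%N -> 1 < k%:R * complex.Re s ->
  cvgn (rdsum (complex.Re s) (ddil k dzeta)) /\
  dirichlet (ddil k dzeta) s = zeta (k%:R * s).
Proof.
move=> k_gt0 ks_gt1; set sigma := complex.Re s.
have cvg_p := cvg_rdsum_dzeta ks_gt1.
pose p := rdsum (k%:R * sigma) dzeta.
pose q := rdsum sigma (ddil k dzeta).
have cutE (X : nmodType) (F G : nat -> X) N :
    (forall m, (0 < m)%N -> F m = G m) ->
  \sum_(1 <= m < N.+1 | (m ^ k <= N)%N) F m +
    \sum_(1 <= m < N.+1 | ~~ (m ^ k <= N)%N) G m =
  \sum_(1 <= m < N.+1) G m.
  move=> FG; rewrite [RHS](bigID (fun m => m ^ k <= N)%N) /=; congr (_ + _).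
  by rewrite big_nat_cond [RHS]big_nat_cond; apply: eq_bigr => m /andP[/andP[/FG]].
have qE N := dsum_ddil (rpowN sigma) N k_gt0.
have vE N := dsum_ddil (fun n => npowN n s) N k_gt0.
have pE N : p N = \sum_(1 <= m < N.+1) rpowN (k%:R * sigma) m.
  by apply: eq_bigr => m _; rewrite mul1r.
have uE N : dpartial dzeta (k%:R * s) N = \sum_(1 <= m < N.+1) npowN m (k%:R * s).
  by apply: eq_bigr => m _; rewrite mul1r.
have pqE N : p N - q N =
    \sum_(1 <= m < N.+1 | ~~ (m ^ k <= N)%N) rpowN (k%:R * sigma) m.
  apply/eqP; rewrite subr_eq addrC; apply/eqP.
  rewrite /q /rdsum qE pE -(@cutE _ (fun m => rpowN sigma (m ^ k))) //.
  by move=> m m_gt0; rewrite rpowNX.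
have [] := @cvgc_truncation R (dpartial dzeta (k%:R * s))
    (dpartial (ddil k dzeta) s) p q (fun N => N ^ k)%N (zeta (k%:R * s)).
- move=> N; rewrite pqE uE dpartialE vE.
  rewrite -(@cutE _ (fun m => npowN (m ^ k) s)) => [|m m_gt0].
    rewrite addrC addKr rmorph_sum; apply: le_trans (ler_norm_sum _ _ _) _.
    by apply: ler_sum => m _; rewrite norm_npowN Re_natMl.
  by rewrite npowNX.
- exact: rdsum_homo.
- move=> N; rewrite -subr_ge0 pqE sumr_ge0 // => m _; exact/ltW/rpowN_gt0.
- move=> N; rewrite /q /rdsum qE pE.
  have N_le : (N.+1 <= (N ^ k).+1)%N.
    by rewrite ltnS; case: (N) => // n; rewrite -[X in (X <= _)%N]expn1 leq_pexp2l.
  rewrite [leRHS](big_cat_nat _ (n := N.+1)) //= -[leLHS]addr0 lerD //; last first.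
    by apply: sumr_ge0 => m _; exact/ltW/rpowN_gt0.
  rewrite le_eqVlt; apply/orP; left; apply/eqP.
  rewrite big_nat [RHS]big_nat_cond; apply: eq_big => [m|m /andP[m_gt0 _]].
    by apply/esym/andb_idr => /andP[_ m_le]; rewrite leq_exp2r.
  by rewrite rpowNX.
- by move=> [|n] //; rewrite -[X in (X <= _)%N]expn1 leq_pexp2l.
- exact: cvg_p.
- by apply: cvg_dirichlet; apply: cvg_dpartial; rewrite Re_natMl.
by move=> cvg_q v_lim; split=> //; apply: (cvg_lim _ v_lim); apply: norm_hausdorff.
Qed.

End Products.

End Analysis.

Theorem theorem1 :
  (forall n : nat, (0 < n)%N ->
     gcount n 2 2 =
     (dzeta * ddil 2 dzeta * (ddil 3 dzeta * ddil 3 dzeta) * ddil 4 dzeta)%D n)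
  /\
  (forall (R : realType) (s : R[i]), 1 < complex.Re s ->
     cvgn (dpartial (fun n => gcount n 2 2) s) /\
     dirichlet (fun n => gcount n 2 2) s =
     zeta s * zeta (2%:R * s) * zeta (3%:R * s) ^+ 2 * zeta (4%:R * s)).
Proof.
split=> [n n_gt0|R s s_gt1]; first exact: gcount_dirichlet.
(* Partial sums start at index 1, so the coefficient identity for positive [n] identifies the two
   series. *)
have partE : dpartial (fun n => gcount n 2 2) s = dpartial
    (dzeta * ddil 2 dzeta * (ddil 3 dzeta * ddil 3 dzeta) * ddil 4 dzeta)%D s.
  apply/funext => N; apply: eq_big_nat => n /andP[n_gt0 _].
  by rewrite gcount_dirichlet.
have cvg_ddil k : (0 < k)%N -> 1 < k%:R * complex.Re s.
  by move=> k_gt0; rewrite (lt_le_trans s_gt1) // ler_peMl ?ler1n //; lra.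
have cvg1 := cvg_rdsum_dzeta s_gt1.
have [cvg2 zeta2] := dirichlet_ddil (k := 2) isT (cvg_ddil 2 isT).
have [cvg3 zeta3] := dirichlet_ddil (k := 3) isT (cvg_ddil 3 isT).
have [cvg4 zeta4] := dirichlet_ddil (k := 4) isT (cvg_ddil 4 isT).
have [cvg12 zeta12] := dirichlet_dmul cvg1 cvg2.
have [cvg33 zeta33] := dirichlet_dmul cvg3 cvg3.
have [cvg123 zeta123] := dirichlet_dmul cvg12 cvg33.
have [cvg1234 zeta1234] := dirichlet_dmul cvg123 cvg4.
rewrite /dirichlet partE; split; first exact: cvg_dpartial.
by rewrite -/(dirichlet _ s) zeta1234 zeta123 zeta12 zeta33 zeta2 zeta3 zeta4 expr2.
Qed.
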